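(* Let $K$ be a convex domain in $\mathbb{E}^2$. If $\delta_{sep}(K)$ denotes the largest (upper) density of totally separable translative packings of $K$ in $\mathbb{E}^2$, then $$\delta_{sep}(K) = \frac{\operatorname{area}(K)}{\operatorname{area}(\square(K))}.$$
   Context: $\mathbb{E}^2$ is the Euclidean plane. A convex domain is a compact convex set with non-empty interior in $\mathbb{E}^2$. A family of translates of $K$ is a packing if no two members have an interior point in common; a packing $\mathcal F$ of translates of $K$ is totally separable if any two members of $\mathcal F$ can be separated by a line which is disjoint from the interiors of all members of $\mathcal F$. The (upper) density of a packing $\mathcal F$ is $\limsup_{r\to\infty} \frac{\operatorname{area}((\bigcup\mathcal F)\cap rB)}{\operatorname{area}(rB)}$, where $B$ is the closed unit disk centered at the origin; $\delta_{sep}(K)$ is the supremum of the upper densities over all totally separable packings of translates of $K$. $\square(K)$ denotes a minimal area parallelogram circumscribed about $K$. *)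

(* Defs.v *)
From mathcomp Require Import all_boot all_order all_algebra.
From mathcomp Require Import all_classical all_reals all_analysis.

Set Implicit Arguments.
Unset Strict Implicit.
Unset Printing Implicit Defensive.

Import Order.TTheory GRing.Theory Num.Theory.
Import numFieldNormedType.Exports.

Local Open Scope classical_set_scope.
Local Open Scope ring_scope.

(* The plane is [R * R].  The library's norm on this type is the sup norm; it
   induces the Euclidean topology, which is all that [compact] and the interior
   use.  The Euclidean metric itself only enters through [unit_disk]. *)

Definition area (R : realType) (A : set (R * R)) : \bar R :=
  (@lebesgue_measure R \x @lebesgue_measure R)%E A.

Definition convex_domain (R : realType) (K : set (R * R)) : Prop :=
  [/\ compact K, convex_set K & K° !=set0].

Definition translate (R : realType) (K : set (R * R)) (t : R * R)
    : set (R * R) :=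
  [set x + t | x in K].

(* A family of translates is a set of sets: a repeated member would overlap
   itself, so nothing is lost by not indexing the family. *)
Definition family_of_translates (R : realType) (K : set (R * R))
    (F : set (set (R * R))) : Prop :=
  forall A, F A -> exists t, A = translate K t.

Definition packing (R : realType) (F : set (set (R * R))) : Prop :=
  forall A B, F A -> F B -> A <> B -> A° `&` B° = set0.

(* When [(a, b) != (0, 0)], [line a b c] is a line.  The two closed half-planes
   it bounds may be exchanged by negating [a], [b] and [c], so the orientation
   chosen in [separates] is immaterial. *)
Definition line (R : realType) (a b c : R) : set (R * R) :=
  [set x | a * x.1 + b * x.2 = c].

Definition separates (R : realType) (a b c : R) (A B : set (R * R)) : Prop :=
  (forall x, A x -> a * x.1 + b * x.2 <= c) /\
  (forall x, B x -> c <= a * x.1 + b * x.2).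

Definition totally_separable (R : realType) (F : set (set (R * R))) : Prop :=
  forall A B, F A -> F B -> A <> B ->
    exists a b c : R,
      [/\ (a, b) <> (0, 0), separates a b c A B
        & forall C, F C -> line a b c `&` C° = set0].

Definition unit_disk (R : realType) : set (R * R) :=
  [set x | x.1 ^+ 2 + x.2 ^+ 2 <= 1].

Definition dilate (R : realType) (r : R) (A : set (R * R)) : set (R * R) :=
  [set r *: x | x in A].

Definition upper_density (R : realType) (F : set (set (R * R))) : \bar R :=
  limf_esup (fun r : R =>
    (area ((\bigcup_(A in F) A) `&` dilate r (@unit_disk R))
       / area (dilate r (@unit_disk R)))%E)
    (pinfty_nbhs R).

Definition delta_sep (R : realType) (K : set (R * R)) : \bar R :=
  ereal_sup [set upper_density F | F in
    [set F | [/\ family_of_translates K F, packing F & totally_separable F]]].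

Definition segment (R : realType) (p u : R * R) : set (R * R) :=
  [set p + s *: u | s in `[0, 1]].

(* The parallelogram with vertices [p], [p + u], [p + u + v] and [p + v]; it is
   non-degenerate when [u.1 * v.2 - u.2 * v.1 != 0]. *)
Definition parallelogram (R : realType) (p u v : R * R) : set (R * R) :=
  [set x | exists s t : R,
    [/\ 0 <= s <= 1, 0 <= t <= 1 & x = p + s *: u + t *: v]].

Definition circumscribed_parallelogram (R : realType) (K P : set (R * R))
    : Prop :=
  exists p u v : R * R,
    [/\ u.1 * v.2 - u.2 * v.1 != 0, P = parallelogram p u v, K `<=` P
      & [/\ segment p u `&` K !=set0, segment (p + v) u `&` K !=set0,
            segment p v `&` K !=set0 & segment (p + u) v `&` K !=set0]].

Definition min_area_circumscribed_parallelogram (R : realType)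
    (K P : set (R * R)) : Prop :=
  circumscribed_parallelogram K P /\
  forall Q, circumscribed_parallelogram K Q -> (area P <= area Q)%E.

(* Main.v *)
From HB Require Import structures.
Require Import Defs.
From mathcomp Require Import all_boot all_order all_algebra.
From mathcomp Require Import all_classical all_reals all_analysis.
From mathcomp Require Import measurable_realfun ring lra.

Set Implicit Arguments.
Unset Strict Implicit.
Unset Printing Implicit Defensive.

Import Order.TTheory GRing.Theory Num.Theory.
Import numFieldNormedType.Exports.

Local Open Scope classical_set_scope.
Local Open Scope ring_scope.

(** Write [w] for the width of [K] in the direction of a linear functional. A
    parallelogram circumscribed about [K] is cut out by two strips of functionals
    [f] and [g], and its area is [w f * w g / |det (f, g)|]. So the least area
    [A] is the largest number with [|det (f, g)| * A <= w f * w g] for all [f]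
    and [g], and it is attained by compactness ([min_parallelogram]).

    The minimal parallelogram tiles the plane by a lattice, and the lines of the
    tiling separate the lattice packing of [K] totally; its density is
    [area K / A] ([upper_density_lattice_ge]).

    For the upper bound, a line missing the interiors of all the members of a
    packing of translates of [K] becomes, in terms of the translation vectors, an
    open strip of the width of [K] without any of these vectors. Strips only see
    widths, so [K] may be replaced by the centrally symmetric body
    [W = (K - K) / 2]. The bound follows from a statement about finite sets:
    if [n] points of a compact convex set [S] are separated from one another by
    such strips, then [n * A <= area (S + W) - area W + A]
    ([count_strip_separated]). For a disk [S] of radius [r] the right-hand side
    is the area of the disk up to an error linear in [r].

    That statement is proved by cutting [S] along the strips one after the
    other. It has to be shown that, when an open strip is removed from [S], the
    areas of the two remaining parts plus [W] and the number [A] add up to at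
    most [area (S + W) + area W] ([vol_sum_strip]). This rests on three facts
    about the area of [S + W] as a function of [S]: it is a valuation on convex
    sets ([vol_sum_cut]); when [S] is a sum of segments it is computed by
    sweeping [W] along the segments ([vol_minkowski_segment]); and, [W] being
    symmetric, a triangle accounts for half of the parallelogram obtained by
    doubling it ([vol_sum_triangle]). The strip cuts two parallel chords out of
    [S]. The trapezoid they span is cut by a diagonal into two triangles, the
    contributions of the chords cancel, and what is left are the two legs of the
    trapezoid. A leg crosses the strip, and by the definition of [A] the body [W]
    gains at least the area [A] when it is swept along it
    ([vol_sum_crossing]). *)

(** * Area under affine maps *)

Definition det2 (R : pzRingType) (u v : R * R) : R := u.1 * v.2 - u.2 * v.1.

Definition linmap (R : realType) (u v x : R * R) : R * R :=
  x.1 *: u + x.2 *: v.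

Lemma linmapE (R : realType) (u v x : R * R) :
  linmap u v x = (x.1 * u.1 + x.2 * v.1, x.1 * u.2 + x.2 * v.2).
Proof. by []. Qed.

(** The plane is second countable: an open set is the union of the boxes with
    rational centres and radii [1 / n] that it contains. *)
Lemma open_measurable2 (R : realType) (U : set (R * R)) : open U -> measurable U.
Proof.
move=> oU.
pose box (q : rat * rat * nat) : set (R * R) :=
  ball (ratr q.1.1 : R) (q.2.+1%:R^-1 : R) `*` ball (ratr q.1.2 : R) (q.2.+1%:R^-1 : R).
have -> : U = \bigcup_q (if `[< box q `<=` U >] then box q else set0).
  apply/seteqP; split=> [x Ux|x [q _]]; last first.
    by case: ifP => // /asboolP; exact.
  have [e /= e0 eU] : exists2 e : R, 0 < e & ball x e `<=` U.
    by apply/nbhs_ballP; exact: open_nbhs_nbhs.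
  have [n ne] : exists n : nat, n.+1%:R^-1 < e / 2.
    have := near_infty_natSinv_lt (PosNum (divr_gt0 e0 (ltr0n R 2))).
    by case=> n _ /(_ n (leqnn n)) /= H; exists n.
  have n0 : 0 < n.+1%:R^-1 :> R by rewrite invr_gt0.
  move: ne n0 => + + ; set d : R := n.+1%:R^-1 => de d0.
  have appr (y : R) : exists q : rat, `|ratr q - y| < d.
    have yy : y - d < y + d by lra.
    have [q] := rat_in_itvoo yy; rewrite in_itv /= => /andP[? ?].
    by exists q; rewrite ltr_norml; apply/andP; split; lra.
  have [[q1 q1x] [q2 q2x]] := (appr x.1, appr x.2).
  exists (q1, q2, n) => //; case: asboolP => [_|[]].
    by split; rewrite /= -ball_normE.
  move=> z [] /=; rewrite -!ball_normE /= -/d => z1 z2; apply: eU.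
  split; rewrite /= -ball_normE /=.
    apply: (@le_lt_trans _ _ (`|ratr q1 - x.1| + `|ratr q1 - z.1|)); last by lra.
    by rewrite (distrC (ratr q1) x.1); exact: ler_distD.
  apply: (@le_lt_trans _ _ (`|ratr q2 - x.2| + `|ratr q2 - z.2|)); last by lra.
  by rewrite (distrC (ratr q2) x.2); exact: ler_distD.
apply: countable_bigcupT_measurable; first exact: countableP.
move=> q; case: ifP => // _; apply: measurableX; apply: open_measurable;
  exact: ball_open.
Qed.

Lemma closed_measurable2 (R : realType) (F : set (R * R)) : closed F -> measurable F.
Proof. by move=> /closed_openC /open_measurable2 /measurableC; rewrite setCK. Qed.

Lemma hausdorff2 (R : realType) : hausdorff_space (R * R)%type.
Proof. exact: norm_hausdorff. Qed.

Lemma compact_measurable2 (R : realType) (F : set (R * R)) :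
  compact F -> measurable F.
Proof.
by move=> /compact_closed => /(_ (@hausdorff2 R)); exact: closed_measurable2.
Qed.

Lemma compactI2 (R : realType) (X Y : set (R * R)) : compact X -> compact Y -> compact (X `&` Y).
Proof.
by move=> cX cY; apply: compact_closedI => //; apply: compact_closed => //; exact: hausdorff2.
Qed.

Section area_linear.
Variable R : realType.
Implicit Types (A B : set (R * R)) (f : R * R -> R * R).
Local Notation mu := (@lebesgue_measure R).

Local Notation pushforward_measure :=
  measure_function_pushforward__canonical__measure_function_Measure.
Local Notation plane := (measurableTypeR R * measurableTypeR R)%type.

Let area_set0 : area (set0 : set (R * R)) = 0%E.
Proof. exact: (measure0 (mu \x mu)%E). Qed.

Let area_nonneg A : (0 <= area A)%E.
Proof. exact: (measure_ge0 (mu \x mu)%E). Qed.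

Let area_sigma_additive : semi_sigma_additive (@area R).
Proof. exact: (@measure_semi_sigma_additive _ _ _ (mu \x mu)%E). Qed.

HB.instance Definition _ := isMeasure.Build _ (R * R)%type R (@area R)
  area_set0 area_nonneg area_sigma_additive.

Lemma areaX (A B : set R) : measurable A -> measurable B ->
  area (A `*` B) = (mu A * mu B)%E.
Proof. by move=> mA mB; rewrite /area product_measure1E. Qed.

(** A measurable map [f] along which areas are multiplied by [k]: stated with
    preimages, which keep sets measurable, so that such maps compose. *)
Definition area_scaling f (k : R) : Prop :=
  [/\ measurable_fun setT f, 0 <= k &
      forall A, measurable A -> area A = (k%:E * area (f @^-1` A))%E].

Lemma area_scaling_comp f g k l :
  area_scaling f k -> area_scaling g l -> area_scaling (f \o g) (k * l).
Proof.
move=> [mf k0 kf] [mg l0 lg]; split.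
- exact: measurableT_comp.
- exact: mulr_ge0.
- move=> A mA; rewrite kf// lg; last by rewrite -[X in measurable X]setTI; exact: mf.
  by rewrite muleA -EFinM.
Qed.

(** Both sides define measures, which need only be compared on half-open
    intervals. *)
Lemma lebesgue_measure_affine (a b : R) (A : set R) : a != 0 -> measurable A ->
  mu A = (`|a|%:E * mu ((fun x => (a * x + b)%R) @^-1` A))%E.
Proof.
move=> a0 mA.
have mf : measurable_fun [set: R] (fun x => a * x + b).
  by apply: measurable_funD => //; exact: measurable_funM.
have a0' : 0 <= `|a| by [].
have mf' : @measurable_fun _ _ (measurableTypeR R) (measurableTypeR R) setT
  (fun x => a * x + b) := mf.
pose m' : {measure set (measurableTypeR R) -> \bar R} :=
  mscale (NngNum a0') (pushforward_measure mu mf').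
suff H : mu A = m' A by rewrite H.
apply: lebesgue_measure_unique => // _ [[u v] _ <-] /=.
rewrite /m' /mscale /=.
have [uv|uv] := ltP u v; last first.
  by rewrite set_itv_ge -?leNgt ?bnd_simp //= /pushforward preimage_set0 !measure0 mule0.
have [ap|an] := ltP 0 a.
  rewrite gtr0_norm //.
  rewrite [pushforward _ _ _](_ : _ = mu `](u - b) / a, (v - b) / a]%classic); last first.
    rewrite /pushforward; congr (mu _).
    apply/seteqP; split=> x /=; rewrite !in_itv /=;
      by rewrite ltr_pdivrMr // ler_pdivlMr // ltrBlDr lerBrDr mulrC.
  rewrite !lebesgue_measure_itv /= !lte_fin uv ltr_pM2r ?invr_gt0// ltrD2r uv
    -!EFinB -EFinM; congr EFin.
  by field; rewrite a0.
have {}an : a < 0 by rewrite lt_neqAle a0.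
rewrite ltr0_norm //.
rewrite [pushforward _ _ _](_ : _ = mu `[(v - b) / a, (u - b) / a[%classic); last first.
  rewrite /pushforward; congr (mu _).
  apply/seteqP; split=> x /=; rewrite !in_itv /=;
    by rewrite ltr_ndivlMr // ler_ndivrMr // ltrBlDr lerBrDr mulrC andbC.
rewrite !lebesgue_measure_itv /= !lte_fin uv ltr_nM2r ?invr_lt0// ltrD2r uv
    -!EFinB -EFinM; congr EFin.
by field; rewrite a0.
Qed.

Let diag (a b p q : R) (x : R * R) := (a * x.1 + p, b * x.2 + q).

Let area_scaling_diag (a b p q : R) : a != 0 -> b != 0 ->
  area_scaling (diag a b p q) (`|a * b|).
Proof.
move=> a0 b0.
have mf : measurable_fun [set: R * R] (diag a b p q).
  apply: measurable_fun_pair; apply: measurable_funD => //; exact: measurable_funM.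
have ab0 : 0 <= `|a * b| by [].
split => // A mA.
have mf' : @measurable_fun _ _ plane plane setT (diag a b p q) := mf.
pose m' : {measure set plane -> \bar R} :=
  mscale (NngNum ab0) (pushforward_measure (mu \x mu)%E mf').
suff H : (mu \x mu)%E A = m' A by rewrite /area H.
apply: product_measure_unique => // B C mB mC.
transitivity (`|a * b|%:E * (mu \x mu) (diag a b p q @^-1` (B `*` C)))%E; first by [].
rewrite normrM EFinM.
rewrite (_ : diag a b p q @^-1` (B `*` C) =
  ((fun x => a * x + p) @^-1` B) `*` ((fun x => b * x + q) @^-1` C)) //.
have maff (u v : R) D : measurable D -> measurable ((fun x : R => u * x + v) @^-1` D).
  move=> mD; rewrite -[X in measurable X]setTI.
  by apply: (measurable_funD (measurable_funM _ _) _) => //.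
rewrite product_measure1E; [|exact: maff|exact: maff].
apply/esym/(etrans (f_equal2 mule (lebesgue_measure_affine p a0 mB)
  (lebesgue_measure_affine q b0 mC))).
by rewrite !muleA; congr (_ * _)%E; rewrite -!muleA; congr (_ * _)%E; rewrite muleC.
Qed.

Let swap (x : R * R) := (x.2, x.1).

Let area_scaling_swap : area_scaling swap 1.
Proof.
have mf : measurable_fun [set: R * R] swap by apply: measurable_fun_pair.
split => // A mA; rewrite mul1e.
have mf' : @measurable_fun _ _ plane plane setT swap := mf.
pose m' : {measure set plane -> \bar R} :=
  pushforward_measure (mu \x mu)%E mf'.
suff H : (mu \x mu)%E A = m' A by rewrite /area H.
apply: product_measure_unique => // B C mB mC.
transitivity ((mu \x mu) (swap @^-1` (B `*` C)))%E; first by [].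
rewrite (_ : swap @^-1` (B `*` C) = C `*` B); last first.
  by apply/seteqP; split=> x [] /=.
by rewrite product_measure1E // muleC.
Qed.

Let shear (k : R) (x : R * R) := (x.1, x.2 + k * x.1).

(* A shear translates each vertical section. *)
Let area_scaling_shear k : area_scaling (shear k) 1.
Proof.
have mf : measurable_fun [set: R * R] (shear k).
  by apply: measurable_fun_pair => //; apply: measurable_funD => //; exact: measurable_funM.
split => // A mA; rewrite mul1e /area /product_measure1.
apply: eq_integral => x _ /=.
have mx : measurable (xsection A x) by exact: measurable_xsection.
rewrite (@lebesgue_measure_affine 1 (k * x) (xsection A x)) ?oner_eq0 //.
rewrite normr1 mul1e; congr mu; apply/seteqP; split => y /=;
  by rewrite /xsection /= !inE /= mul1r.
Qed.

(** Gaussian elimination writes an invertible matrix as a product of shears,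
    scalings of the axes and exchanges of the axes. *)
Lemma area_scaling_linmap (u v : R * R) : det2 u v != 0 ->
  area_scaling (linmap u v) `|det2 u v|.
Proof.
have gen (a b c d : R) : a != 0 -> a * d - c * b != 0 ->
    area_scaling (linmap (a, c) (b, d)) `|a * d - c * b|.
  move=> a0 d0.
  rewrite (_ : linmap _ _ = shear (c / a) \o diag a ((a * d - c * b) / a) 0 0 \o
            swap \o shear (b / a) \o swap); last first.
    apply/funext => -[x y]; rewrite linmapE /shear /diag /swap /=.
    by congr pair; field.
  rewrite (_ : `|a * d - c * b| = 1 * `|a * ((a * d - c * b) / a)| * 1 * 1 * 1); last first.
    by rewrite !mulr1 mul1r; congr (`|_|); field.
  do 4! (apply: area_scaling_comp => //).
  by apply: area_scaling_diag => //; rewrite mulf_neq0 ?invr_eq0.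
case: u v => [a c] [b d]; rewrite /det2 /= => D0.
have [a0|a0] := eqVneq a 0; last by exact: gen.
move: D0; rewrite a0 mul0r sub0r => D0.
rewrite (_ : linmap _ _ = swap \o linmap (c, 0) (d, b)); last first.
  by apply/funext => -[x y]; rewrite !linmapE /swap /=.
rewrite (_ : `|- (c * b)| = 1 * `|c * b - 0 * d|); last by rewrite mul0r subr0 mul1r normrN.
apply: area_scaling_comp => //; apply: gen.
  by move: D0; rewrite oppr_eq0 mulf_eq0 => /norP[].
by rewrite mul0r subr0 -oppr_eq0.
Qed.

Lemma area_scaling_translation (t : R * R) : area_scaling (fun x => x + t) 1.
Proof.
rewrite (_ : (fun x => x + t) = diag 1 1 t.1 t.2); last first.
  by apply/funext => -[x y]; rewrite /diag /= !mul1r.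
by rewrite -[X in area_scaling _ X]normr1 -[X in `|X|]mulr1; apply: area_scaling_diag; exact: oner_neq0.
Qed.

Lemma area_linmap (u v : R * R) A : det2 u v != 0 -> measurable A ->
  area (linmap u v @` A) = (`|det2 u v|%:E * area A)%E.
Proof.
move=> D0 mA.
pose u' := (v.2 / det2 u v, - u.2 / det2 u v).
pose v' := (- v.1 / det2 u v, u.1 / det2 u v).
have D'0 : det2 u' v' != 0.
  rewrite (_ : det2 u' v' = (det2 u v)^-1) ?invr_eq0 //.
  by rewrite /u' /v' /det2 /=; field.
have K : cancel (linmap u v) (linmap u' v').
  move=> -[x y]; rewrite !linmapE /u' /v' /= /det2.
  by congr pair => /=; field.
have K' : cancel (linmap u' v') (linmap u v).
  move=> -[x y]; rewrite !linmapE /u' /v' /= /det2.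
  by congr pair => /=; field.
have [m' _ _] := area_scaling_linmap D'0.
have [_ _ ->] := area_scaling_linmap D0.
  congr (_ * _)%E; congr area; apply/seteqP; split => x /=; last by exists x.
  by case=> y Ay /(can_inj K) <-.
rewrite (_ : linmap u v @` A = linmap u' v' @^-1` A).
  by rewrite -[X in measurable X]setTI; exact: m'.
apply/seteqP; split => x /=; first by case=> y Ay <-; rewrite K.
by move=> Ax; exists (linmap u' v' x); rewrite ?K'.
Qed.

Lemma area_translate A t : measurable A -> area (translate A t) = area A.
Proof.
move=> mA.
have [m' _ _] := area_scaling_translation (- t).
have [_ _ H] := area_scaling_translation t.
rewrite H.
  rewrite mul1e; congr area; apply/seteqP; split => x /=; last by exists x.
  by case=> y Ay /addIr <-.
rewrite (_ : translate A t = (fun x => x - t) @^-1` A).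
  by rewrite -[X in measurable X]setTI; exact: m'.
apply/seteqP; split => x /=; first by case=> y Ay <-; rewrite addrK.
by move=> Ax; exists (x - t); rewrite ?subrK.
Qed.

Lemma area_opp A : measurable A -> area [set - x | x in A] = area A.
Proof.
move=> mA; have D1 : det2 (-1, 0) (0, -1) != 0 :> R.
  by rewrite /det2 /= mul0r subr0 mulrNN mulr1 oner_neq0.
have := area_linmap D1 mA.
rewrite (_ : `|_| = 1) ?mul1e; last by rewrite /det2 /= mul0r subr0 mulrNN mulr1 normr1.
move=> <-; congr area; apply: eq_imagel => -[x y] _.
by rewrite linmapE; congr pair; rewrite /= !(mulr0, mulrN1, addr0, add0r).
Qed.

End area_linear.

(** * Linear functionals, convex bodies and widths *)

Section convex_bodies.
Variable R : realType.
Implicit Types (X Y : set (R * R)) (f e x y z : R * R).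

Lemma pair_ext x y : x.1 = y.1 -> x.2 = y.2 -> x = y.
Proof. by case: x y => [? ?] [? ?] /= -> ->. Qed.

Definition dot f x : R := f.1 * x.1 + f.2 * x.2.

Definition perp e : R * R := (- e.2, e.1).

Lemma dot_perp e x : dot (perp e) x = det2 e x.
Proof. by rewrite /dot /perp /det2 /=; ring. Qed.

Lemma dotD f x y : dot f (x + y) = dot f x + dot f y.
Proof. by rewrite /dot /=; ring. Qed.

Lemma dotZ f (a : R) x : dot f (a *: x) = a * dot f x.
Proof. by rewrite /dot /= /GRing.scale /=; ring. Qed.

Lemma dotN f x : dot f (- x) = - dot f x.
Proof. by rewrite /dot /=; ring. Qed.

Lemma dotB f x y : dot f (x - y) = dot f x - dot f y.
Proof. by rewrite dotD dotN. Qed.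

Lemma dot0 f : dot f 0 = 0.
Proof. by rewrite /dot /= !mulr0 addr0. Qed.

Lemma dot_self_gt0 f : f != 0 -> 0 < dot f f.
Proof.
move=> f0; rewrite lt_neqAle /dot -!expr2 addr_ge0 ?sqr_ge0// andbT.
apply: contra_neq f0 => /esym/eqP; rewrite paddr_eq0 ?sqr_ge0// !sqrf_eq0.
by move=> /andP[/eqP ? /eqP ?]; exact: pair_ext.
Qed.

Lemma dot_continuous f : continuous (dot f).
Proof.
move=> x; apply: cvgD; apply: cvgM; try exact: cvg_cst.
  exact: cvg_fst.
exact: cvg_snd.
Qed.

Lemma linmap_continuous (u v : R * R) : continuous (linmap u v).
Proof.
move=> x; apply: cvgD.
  by apply: (@cvgZ _ _ _ _ _ fst (cst u)); [exact: cvg_fst|exact: cvg_cst].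
by apply: (@cvgZ _ _ _ _ _ snd (cst v)); [exact: cvg_snd|exact: cvg_cst].
Qed.

Lemma convex_setP X : convex_set X <->
  forall x y (s : R), X x -> X y -> 0 <= s <= 1 -> X (x + s *: (y - x)).
Proof.
split=> [cX x y s Xx Xy /andP[s0 s1]|cX x y s].
  have s'0 : 0 <= 1 - s by rewrite subr_ge0.
  have s'1 : 1 - s <= 1 by lra.
  have := cX x y (Itv01 s'0 s'1); rewrite !inE => /(_ Xx Xy).
  by congr X; apply: pair_ext; rewrite /= /GRing.scale /= /unstable.onem; ring.
rewrite !inE => Xx Xy.
have := cX x y (1 - s%:num) Xx Xy.
rewrite subr_ge0 lerBlDr lerDl ge0 le1 => /(_ isT).
by congr X; apply: pair_ext; rewrite /= /GRing.scale /= /unstable.onem; ring.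
Qed.

Definition minkowski_sum X Y : set (R * R) := [set x + y | x in X & y in Y].

Definition compact_convex X := compact X /\ convex_set X.

Lemma continuous_image_compact (T U : topologicalType) (g : T -> U) (A : set T) :
  continuous g -> compact A -> compact (g @` A).
Proof.
by move=> cg; apply: continuous_compact; exact: continuous_subspaceT.
Qed.

Lemma segmentP p u x : segment p u x <-> exists2 s : R, 0 <= s <= 1 & x = p + s *: u.
Proof.
by split=> [[s /= + <-]|[s s01 ->]]; [rewrite in_itv /=; exists s|exists s; rewrite //= in_itv].
Qed.

Lemma segment_compact_convex p u : compact_convex (segment p u).
Proof.
split.
  apply: continuous_image_compact; last exact: segment_compact.
  move=> s; apply: cvgD; first exact: cvg_cst.
  by apply: (@cvgZ _ _ _ _ _ id (cst u)); [exact: cvg_id|exact: cvg_cst].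
apply/convex_setP => x y s /segmentP[a a01 ->] /segmentP[b b01 ->] s01.
apply/segmentP; exists (a + s * (b - a)); first by nra.
by apply: pair_ext; rewrite /= /GRing.scale /=; ring.
Qed.

Lemma minkowski_sum_compact_convex X Y :
  compact_convex X -> compact_convex Y -> compact_convex (minkowski_sum X Y).
Proof.
move=> [cX vX] [cY vY]; split.
  rewrite (_ : minkowski_sum X Y = (fun z : (R * R) * (R * R) => z.1 + z.2) @` (X `*` Y)).
    apply: continuous_image_compact; last exact: compact_setX.
    by move=> z; apply: cvgD; [exact: cvg_fst|exact: cvg_snd].
  apply/seteqP; split=> z /=.
    by case=> x Xx [y Yy <-]; exists (x, y).
  by case=> -[x y] [/= Xx Yy] <-; exists x => //; exists y.
move/convex_setP in vX; move/convex_setP in vY.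
apply/convex_setP => _ _ s [x Xx [y Yy <-]] [x' Xx' [y' Yy' <-]] s01.
exists (x + s *: (x' - x)); first exact: vX.
exists (y + s *: (y' - y)); first exact: vY.
by apply: pair_ext; rewrite /= /GRing.scale /=; ring.
Qed.

Lemma linmap_compact_convex (u v : R * R) X :
  compact_convex X -> compact_convex (linmap u v @` X).
Proof.
move=> [cX /convex_setP vX]; split.
  by apply: continuous_image_compact => //; exact: linmap_continuous.
apply/convex_setP => _ _ s [x Xx <-] [y Yy <-] s01.
exists (x + s *: (y - x)); first exact: vX.
by rewrite !linmapE; apply: pair_ext; rewrite /= /GRing.scale /=; ring.
Qed.

Lemma convex_setI X Y : convex_set X -> convex_set Y -> convex_set (X `&` Y).
Proof.
move=> /convex_setP vX /convex_setP vY; apply/convex_setP => x y s [? ?] [? ?] s01.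
by split; [exact: vX|exact: vY].
Qed.

Lemma halfplane_le f (c : R) : closed [set x | dot f x <= c] /\ convex_set [set x | dot f x <= c].
Proof.
split.
  apply: (@preimage_closed _ _ (dot f) [set t | t <= c]); last exact: closed_le.
  by move=> x _; exact: dot_continuous.
apply/convex_setP => x y s /= fx fy s01; rewrite dotD dotZ dotB; nra.
Qed.

Lemma halfplane_ge f (c : R) : closed [set x | c <= dot f x] /\ convex_set [set x | c <= dot f x].
Proof.
split.
  apply: (@preimage_closed _ _ (dot f) [set t | c <= t]); last exact: closed_ge.
  by move=> x _; exact: dot_continuous.
apply/convex_setP => x y s /= fx fy s01; rewrite dotD dotZ dotB; nra.
Qed.

Lemma compact_convexI X Y : compact_convex X -> closed Y /\ convex_set Y ->
  compact_convex (X `&` Y).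
Proof.
move=> [cX vX] [cY vY]; split; first exact: compact_closedI.
exact: convex_setI.
Qed.

Lemma line_closed_convex f (c : R) : closed [set x | dot f x = c] /\ convex_set [set x | dot f x = c].
Proof.
rewrite (_ : [set x | dot f x = c] = [set x | dot f x <= c] `&` [set x | c <= dot f x]).
  have [c1 v1] := halfplane_le f c; have [c2 v2] := halfplane_ge f c.
  by split; [exact: closedI|exact: convex_setI].
apply/seteqP; split=> x /=; first by move->.
by case=> ? ?; apply/eqP; rewrite eq_le; apply/andP.
Qed.

Lemma dot_minmax X f : compact X -> X !=set0 ->
  exists x y, [/\ X x, X y & forall z, X z -> dot f x <= dot f z <= dot f y].
Proof.
move=> cX X0.
have cf : {within X, continuous (dot f)}.
  by apply: continuous_subspaceT; exact: dot_continuous.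
have [y /set_mem Xy ymax] := compact_EVT_max X0 cX cf.
have [x /set_mem Xx xmin] := compact_EVT_min X0 cX cf.
by exists x, y; split => // z /mem_set Xz; rewrite xmin// ymax.
Qed.

Definition width X f : R := sup [set dot f (x - y) | x in X & y in X].

Lemma widthE X f x y : X x -> X y ->
  (forall z, X z -> dot f x <= dot f z <= dot f y) -> width X f = dot f y - dot f x.
Proof.
move=> Xx Xy m; rewrite -dotB; apply/eqP; rewrite eq_le; apply/andP; split.
  apply: ge_sup; first by exists (dot f (y - x)); exists y => //; exists x.
  move=> _ [u Xu [v Xv <-]]; rewrite !dotB.
  by have /andP[? ?] := m u Xu; have /andP[? ?] := m v Xv; lra.
apply: ub_le_sup; last by exists y => //; exists x.
exists (dot f (y - x)) => _ [u Xu [v Xv <-]]; rewrite !dotB.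
by have /andP[? ?] := m u Xu; have /andP[? ?] := m v Xv; lra.
Qed.

Lemma interval_of_compact_convex (S : set R) : compact S -> S !=set0 ->
  (forall x y s : R, S x -> S y -> 0 <= s <= 1 -> S (x + s * (y - x))) ->
  exists a b, a <= b /\ S = `[a, b]%classic.
Proof.
move=> cS S0 vS.
have cf : {within S, continuous (id : R -> R)} by apply: continuous_subspaceT => z; exact: cvg_id.
have [b /set_mem Sb bmax] := compact_EVT_max S0 cS cf.
have [a /set_mem Sa amin] := compact_EVT_min S0 cS cf.
exists a, b; have ab : a <= b by apply: amin; exact/mem_set.
split => //; apply/seteqP; split=> x /=; rewrite in_itv /=.
  by move=> /mem_set Sx; rewrite amin// bmax.
move=> /andP[ax xb].
have [eab|nab] := eqVneq a b.
  by have -> : x = a by apply/eqP; rewrite eq_le ax eab xb.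
have ba0 : 0 < b - a by rewrite subr_gt0 lt_neqAle nab.
have -> : x = a + (x - a) / (b - a) * (b - a) by field; rewrite subr_eq0 eq_sym.
apply: vS => //; apply/andP; split; first by rewrite divr_ge0 ?subr_ge0// ltW.
by rewrite ler_pdivrMr// mul1r lerD2r.
Qed.

End convex_bodies.

(** * Area of compact sets, and of a body swept along a segment *)

Section volume.
Variable R : realType.
Implicit Types (X Y : set (R * R)) (f e x y z t : R * R).
Local Notation mu := (@lebesgue_measure R).

Definition vol X : R := fine (area X).

Lemma compact_box X : compact X ->
  exists2 M : R, 0 < M & X `<=` `[-M, M]%classic `*` `[-M, M]%classic.
Proof.
move=> /compact_bounded [M [_ bM]].
have M1 : M < `|M| + 1 by rewrite (le_lt_trans (ler_norm _))// ltrDl.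
have M0 : 0 < `|M| + 1 by rewrite ltr_wpDl.
exists (`|M| + 1) => // x Xx; have := bM _ M1 x Xx.
rewrite /= prod_normE /= ge_max !ler_norml => /andP[/andP[? ?] /andP[? ?]].
by split; rewrite /= in_itv /=; apply/andP.
Qed.

Lemma area_compact X : compact X -> area X = (vol X)%:E.
Proof.
move=> cX; rewrite /vol fineK// ge0_fin_numE//.
have [M M0 XM] := compact_box cX.
have mI : measurable (`[-M, M]%classic : set R) by exact: measurable_itv.
apply: (@le_lt_trans _ _ (area (`[-M, M]%classic `*` `[-M, M]%classic))).
  by apply: le_measure; rewrite ?inE//; [exact: compact_measurable2|exact: measurableX].
rewrite areaX// lebesgue_measure_itv /=; case: ifP => _; last by rewrite mule0 ltry.
by rewrite -EFinM ltry.
Qed.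

Lemma vol_ge0 X : 0 <= vol X.
Proof. by rewrite /vol fine_ge0. Qed.

Lemma le_vol X Y : compact X -> compact Y -> X `<=` Y -> vol X <= vol Y.
Proof.
move=> cX cY XY; rewrite -lee_fin -!area_compact//.
by apply: le_measure; rewrite ?inE//; exact: compact_measurable2.
Qed.

Lemma volUI X Y : compact X -> compact Y ->
  vol (X `|` Y) + vol (X `&` Y) = vol X + vol Y.
Proof.
move=> cX cY; have mX := compact_measurable2 cX; have mY := compact_measurable2 cY.
have cI : compact (X `&` Y) by exact: compactI2.
have cU : compact (X `|` Y) by exact: compactU.
have : area (X `|` Y) = (area X + area Y - area (X `&` Y))%E.
  by apply: (@measureUfinl _ _ _ (@area R)) => //=; rewrite area_compact// ltry.
by rewrite !area_compact// -EFinN -!EFinD => -[->]; rewrite subrK.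
Qed.

Lemma vol_translate X t : measurable X -> vol (translate X t) = vol X.
Proof. by move=> mX; rewrite /vol area_translate. Qed.

Lemma vol_opp X : measurable X -> vol [set - x | x in X] = vol X.
Proof. by move=> mX; rewrite /vol area_opp. Qed.

Lemma vol_linmap (u v : R * R) X : det2 u v != 0 -> compact X ->
  vol (linmap u v @` X) = `|det2 u v| * vol X.
Proof.
move=> D cX; rewrite /vol area_linmap//; last exact: compact_measurable2.
by rewrite area_compact// -EFinM.
Qed.

(** The first coordinate is the functional [(1, 0)], so the length of the
    projection is a width. *)
Lemma fst_itv X : compact_convex X -> X !=set0 ->
  exists a b, [/\ a <= b, fst @` X = `[a, b]%classic & b - a = width X (1, 0)].
Proof.
move=> [cX vX] X0.
have [x [y [Xx Xy m]]] := dot_minmax (1, 0) cX X0.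
have E z : dot (1, 0) z = z.1 by rewrite /dot /= mul1r mul0r addr0.
exists x.1, y.1; split.
- by have /andP[+ _] := m y Xy; rewrite !E.
- apply/seteqP; split => s /=.
    by case=> z /m; rewrite !E => + <-; rewrite in_itv.
  rewrite in_itv /= => /andP[xs sy].
  have [eab|nab] := eqVneq x.1 y.1.
    by exists x => //; apply/eqP; rewrite eq_le xs eab sy.
  have ba0 : 0 < y.1 - x.1 by rewrite subr_gt0 lt_neqAle nab (le_trans xs).
  exists (x + ((s - x.1) / (y.1 - x.1)) *: (y - x)).
    apply: (convex_setP X).1 => //; apply/andP; split.
      by rewrite divr_ge0 ?subr_ge0// (le_trans xs).
    by rewrite ler_pdivrMr// mul1r lerD2r.
  by rewrite /= /GRing.scale /=; field; rewrite subr_eq0 eq_sym.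
- by rewrite (widthE Xx Xy m) !E.
Qed.

Lemma xsection_itv X s : compact_convex X -> xsection X s !=set0 ->
  exists a b, a <= b /\ xsection X s = `[a, b]%classic.
Proof.
move=> [cX /convex_setP vX] Xs0; apply: interval_of_compact_convex => //.
  rewrite (_ : xsection X s = snd @` (X `&` [set x | dot (1, 0) x = s])).
    apply: continuous_image_compact; first by move=> x; exact: cvg_snd.
    by apply: compact_closedI => //; have [] := line_closed_convex (1, 0) s.
  apply/seteqP; split=> y /=.
    rewrite /xsection /= inE => Xsy; exists (s, y) => //; split => //=.
    by rewrite /dot /= mul1r mul0r addr0.
  case=> -[x1 x2] /= [Xx]; rewrite /dot /= mul1r mul0r addr0 => ex <-.
  by rewrite /xsection /= inE -ex.
move=> x y t; rewrite /xsection /= !inE => Xx Xy t01.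
have := vX _ _ t Xx Xy t01; congr X.
by apply: pair_ext; rewrite /= /GRing.scale /= ?subrr ?mulr0 ?addr0.
Qed.

Lemma xsection_minkowski_vertical X s a b : a <= b -> xsection X s = `[a, b]%classic ->
  xsection (minkowski_sum X (segment 0 (0, 1))) s = `[a, b + 1]%classic.
Proof.
move=> ab E; apply/seteqP; split=> y.
  rewrite /xsection /= inE => -[[x1 x2] Xx [_ /segmentP[r r01 ->]]].
  move=> E'; move: (congr1 fst E') (congr1 snd E').
  rewrite /= /GRing.scale /= !add0r mulr0 addr0 mulr1 => es ey.
  have : xsection X s x2 by rewrite /xsection /= inE -es.
  by rewrite E /= !in_itv /= -ey => /andP[? ?]; apply/andP; split; lra.
rewrite /= in_itv /= => /andP[ay yb].
have H r : a <= r <= b -> 0 <= y - r <= 1 -> xsection (minkowski_sum X (segment 0 (0, 1))) s y.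
  move=> rab r01.
  have : xsection X s r by rewrite E /= in_itv.
  rewrite /xsection /= !inE => Xsr; exists (s, r) => //.
  exists (0 + (y - r) *: (0, 1)); first by apply/segmentP; exists (y - r).
  by apply: pair_ext; rewrite /= /GRing.scale /=; ring.
have [yb'|yb'] := leP y b; first by apply: (H y); rewrite ?subrr; lra.
by apply: (H b); rewrite ?ab ?lexx//; lra.
Qed.

Lemma xsection_set0 X (s : R) : ~ (xsection X s !=set0) -> xsection X s = set0.
Proof. by move=> H; apply/seteqP; split=> // y Xy; apply: H; exists y. Qed.

(* Each nonempty vertical section gets longer by [1]. *)
Let area_minkowski_vertical X : compact_convex X -> X !=set0 ->
  area (minkowski_sum X (segment 0 (0, 1))) = (area X + (width X (1, 0))%:E)%E.
Proof.
move=> cX X0.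
have [a [b [ab fE <-]]] := fst_itv cX X0.
have mI : measurable (`[a, b]%classic : set R) by exact: measurable_itv.
have mX := compact_measurable2 cX.1.
transitivity (\int[mu]_x (mu (xsection X x) + (\1_(`[a, b]%classic) x)%:E))%E.
  apply: eq_integral => x _ /=.
  have [xX|xX] := pselect (xsection X x !=set0).
    have [c [d [cd E]]] := xsection_itv cX xX.
    rewrite (xsection_minkowski_vertical cd E) E indicE.
    rewrite mem_set; last first.
      have [y] := xX; rewrite /xsection /= inE => Xxy.
      by have : (fst @` X) x by [exists (x, y)]; rewrite fE.
    rewrite !lebesgue_measure_itv /= !lte_fin.
    have -> : c < d + 1 by lra.
    case: ltP => [_|dc]; rewrite -!EFinB -?EFinD; congr EFin; first by ring.
    have -> : c = d by apply/eqP; rewrite eq_le cd dc.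
    by rewrite /=; ring.
  rewrite indicE memNset; last first.
    move=> xab; have : (fst @` X) x by rewrite fE.
    case=> -[x1 x2] /= Xx ex; apply: xX; exists x2.
    by rewrite /xsection /= inE -ex.
  have E1 : xsection X x = set0 by exact: xsection_set0.
  have E2 : xsection (minkowski_sum X (segment 0 (0, 1))) x = set0.
    apply: xsection_set0.
    move=> [y]; rewrite /xsection /= inE => -[[x1 x2] Xx [_ /segmentP[r _ ->]]].
    move=> E'; move: (congr1 fst E').
    rewrite /= /GRing.scale /= !add0r mulr0 addr0 => es.
    by apply: xX; exists x2; rewrite /xsection /= inE -es.
  by rewrite E1 E2 measure0 add0e.
rewrite ge0_integralD//.
- rewrite integral_indic// setIT; congr (_ + _)%E.
  have E : mu (`[a, b]%classic : set R) =
      (if (a < b)%R then (b - a)%:E else 0)%E by rewrite lebesgue_measure_itv /= lte_fin -EFinB.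
  apply: (etrans E); case: ltP => [//|ba].
  by have -> : a = b by [apply/eqP; rewrite eq_le ab ba]; rewrite subrr.
- exact: measurable_fun_xsection.
- by apply/measurable_EFinP; exact: measurable_indic.
Qed.

Lemma widthN X f : compact X -> X !=set0 -> width X (- f) = width X f.
Proof.
move=> cX X0; have [x [y [Xx Xy m]]] := dot_minmax f cX X0.
have E z : dot (- f) z = - dot f z by rewrite /dot /=; ring.
rewrite (widthE Xx Xy m) (widthE Xy Xx); last first.
  by move=> z /m; rewrite !E !lerN2 andbC.
by rewrite !E; ring.
Qed.

(** Sliding a convex body along [e] sweeps out a strip: every chord parallel to
    [e] gets longer by [e], and these chords fill the width of the body
    transversally to [e]. *)
Lemma vol_minkowski_segment X p e : compact_convex X -> X !=set0 ->
  vol (minkowski_sum X (segment p e)) = vol X + width X (perp e).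
Proof.
move=> cX X0.
have cS : compact_convex (minkowski_sum X (segment 0 e)).
  by apply: minkowski_sum_compact_convex => //; exact: segment_compact_convex.
have -> : minkowski_sum X (segment p e) = translate (minkowski_sum X (segment 0 e)) p.
  apply/seteqP; split=> z /=.
    case=> x Xx [_ /segmentP[s s01 ->] <-]; exists (x + s *: e); last first.
      by apply: pair_ext; rewrite /= /GRing.scale /=; ring.
    exists x => //; exists (s *: e) => //; apply/segmentP; exists s => //.
    by rewrite add0r.
  case=> _ [x Xx [_ /segmentP[s s01 ->] <-] <-]; exists x => //.
  exists (p + s *: e); first by apply/segmentP; exists s.
  by apply: pair_ext; rewrite /= /GRing.scale /=; ring.
rewrite vol_translate; last exact: compact_measurable2 cS.1.
have [e0|e0] := eqVneq e 0.
  have [x Xx] := X0.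
  rewrite (widthE Xx Xx); last first.
    by move=> z _; rewrite !dot_perp e0 /det2 /= !mul0r !subrr lexx.
  rewrite subrr addr0; congr vol; apply/seteqP; split=> z /=.
    by case=> y Xy [_ /segmentP[s s01 ->] <-]; rewrite e0 scaler0 !addr0.
  move=> Xz; exists z => //; exists 0; rewrite ?addr0//.
  by apply/segmentP; exists 0; rewrite ?lexx ?ler01// scale0r addr0.
(* [e] is completed to a basis of determinant [1], so that passing to the
   coordinates in which [e] is vertical preserves areas *)
pose N := dot e e; have N0 : N != 0 by exact: lt0r_neq0 (dot_self_gt0 e0).
pose u : R * R := (e.2 / N, - e.1 / N).
have D1 : det2 u e = 1 by rewrite /N /dot in N0; rewrite /u /N /dot /det2 /=; field.
have D0 : det2 u e != 0 by rewrite D1 oner_neq0.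
clearbody u.
pose L := linmap u e.
pose L' := linmap (e.2, - u.2) (- e.1, u.1).
have L'K : cancel L' L.
  move=> -[x y]; rewrite /L /L' !linmapE /=; move: D1; rewrite /det2 => D1.
  apply: pair_ext => /=; rewrite -[RHS]mul1r -D1; ring.
have LK : cancel L L'.
  move=> -[x y]; rewrite /L /L' !linmapE /=; move: D1; rewrite /det2 => D1.
  apply: pair_ext => /=; rewrite -[RHS]mul1r -D1; ring.
pose Y := L' @` X.
have cY : compact_convex Y by exact: linmap_compact_convex.
have Y0 : Y !=set0 by have [x Xx] := X0; exists (L' x), x.
have XE : X = L @` Y.
  by rewrite /Y image_comp (_ : L \o L' = id) ?image_id//; apply/funext => x /=; rewrite L'K.
have SE : minkowski_sum X (segment 0 e) = L @` (minkowski_sum Y (segment 0 (0, 1))).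
  have Lx x s : L (x + (0 + s *: (0, 1))) = L x + (0 + s *: e).
    by rewrite /L !linmapE; apply: pair_ext; rewrite /= /GRing.scale /=; ring.
  rewrite XE; apply/seteqP; split=> z /=.
    case=> _ [y Yy <-] [_ /segmentP[s s01 ->] <-]; rewrite -Lx; exists (y + (0 + s *: (0, 1))) => //.
    by exists y => //; exists (0 + s *: (0, 1)) => //; apply/segmentP; exists s.
  case=> _ [y Yy [_ /segmentP[s s01 ->] <-]] <-; rewrite Lx; exists (L y); first by exists y.
  by exists (0 + s *: e) => //; apply/segmentP; exists s.
have cS' : compact_convex (minkowski_sum Y (segment 0 (0, 1))).
  by apply: minkowski_sum_compact_convex => //; exact: segment_compact_convex.
have YE : Y = L' @` X by [].
clearbody Y.
rewrite SE [in vol X]XE !vol_linmap//; [|exact: cY.1|exact: cS'.1].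
rewrite D1 normr1 !mul1r.
have : vol (minkowski_sum Y (segment 0 (0, 1))) = vol Y + width Y (1, 0).
  by rewrite {1}/vol area_minkowski_vertical// (area_compact cY.1).
move=> ->; congr (_ + _).
have [x [y [Xx Xy m]]] := dot_minmax (- perp e) cX.1 X0.
rewrite -(widthN _ cX.1 X0) (widthE Xx Xy m).
have E z : dot (1, 0) (L' z) = dot (- perp e) z.
  by rewrite /L' linmapE /perp /dot /=; ring.
rewrite (@widthE _ Y (1, 0) (L' x) (L' y)); first by rewrite !E.
- by rewrite YE; exists x.
- by rewrite YE; exists y.
- by rewrite YE => _ [z Xz <-]; rewrite !E; exact: m.
Qed.

End volume.

(** * Counting points separated by strips *)

Section strip_separation.
Variable R : realType.
Implicit Types (X Y S Z : set (R * R)) (d f e p q r s x y z t : R * R).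

Lemma perpZ (b : R) e : perp (b *: e) = b *: perp e.
Proof. by apply: pair_ext; rewrite /= /GRing.scale /= ?mulrN. Qed.

Lemma perpN e : perp (- e) = - perp e.
Proof. exact: pair_ext. Qed.

Lemma dotZl (b : R) f x : dot (b *: f) x = b * dot f x.
Proof. by rewrite /dot /= /GRing.scale /=; ring. Qed.

Lemma perp_independent d e x : dot (perp d) x = 0 -> dot (perp e) x = 0 ->
  dot (perp e) d != 0 -> x = 0.
Proof.
move=> dx ex ed; apply: pair_ext; apply: (mulIf ed); rewrite mul0r.
  transitivity (d.1 * dot (perp e) x - e.1 * dot (perp d) x).
    by rewrite /dot /perp /=; ring.
  by rewrite dx ex !mulr0 subr0.
transitivity (d.2 * dot (perp e) x - e.2 * dot (perp d) x).
  by rewrite /dot /perp /=; ring.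
by rewrite dx ex !mulr0 subr0.
Qed.

Lemma perp_neq0 d : d != 0 -> perp d != 0.
Proof.
apply: contra_neq => /(congr1 (fun x => (x.2, - x.1))) /=.
by rewrite opprK oppr0 -surjective_pairing.
Qed.

Lemma widthZ X (b : R) f : 0 <= b -> compact X -> X !=set0 ->
  width X (b *: f) = b * width X f.
Proof.
move=> b0 cX X0; have [x [y [Xx Xy m]]] := dot_minmax f cX X0.
rewrite (widthE Xx Xy m) (widthE Xx Xy); first by rewrite !dotZl mulrBr.
by move=> z /m /andP[? ?]; rewrite !dotZl !ler_wpM2l.
Qed.

Lemma width_minkowski_sum X Y f : compact X -> X !=set0 -> compact Y -> Y !=set0 ->
  width (minkowski_sum X Y) f = width X f + width Y f.
Proof.
move=> cX X0 cY Y0; have [x [y [Xx Xy m]]] := dot_minmax f cX X0.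
have [x' [y' [Yx Yy m']]] := dot_minmax f cY Y0.
rewrite (widthE Xx Xy m) (widthE Yx Yy m') (@widthE _ _ _ (x + x') (y + y')).
- by rewrite !dotD; ring.
- by exists x => //; exists x'.
- by exists y => //; exists y'.
- move=> _ [z Xz [z' Yz' <-]]; rewrite !dotD.
  by have /andP[? ?] := m _ Xz; have /andP[? ?] := m' _ Yz'; apply/andP; split; exact: lerD.
Qed.

Lemma segment_left p e : segment p e p.
Proof. by apply/segmentP; exists 0; rewrite ?lexx ?ler01// scale0r addr0. Qed.

Lemma segment_right p e : segment p e (p + e).
Proof. by apply/segmentP; exists 1; rewrite ?lexx ?ler01// scale1r. Qed.

Lemma segment_neq0 p e : segment p e !=set0.
Proof. by exists p; exact: segment_left. Qed.

Lemma width_segment p e f : width (segment p e) f = `|dot f e|.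
Proof.
have [e0|e0] := leP 0 (dot f e).
  rewrite (@widthE _ _ _ p (p + e)); first by rewrite dotD ger0_norm//; ring.
  - exact: segment_left.
  - exact: segment_right.
  - by move=> _ /segmentP[s /andP[s0 s1] ->]; rewrite !dotD dotZ; nra.
rewrite (@widthE _ _ _ (p + e) p); first by rewrite dotD ltr0_norm//; ring.
- exact: segment_right.
- exact: segment_left.
- by move=> _ /segmentP[s /andP[s0 s1] ->]; rewrite !dotD dotZ; nra.
Qed.

Lemma minkowski_sumS X Y Y' : Y `<=` Y' -> minkowski_sum X Y `<=` minkowski_sum X Y'.
Proof. by move=> YY' _ [x Xx [y Yy <-]]; exists x => //; exists y => //; exact: YY'. Qed.

Lemma minkowski_sumA X Y Z :
  minkowski_sum X (minkowski_sum Y Z) = minkowski_sum (minkowski_sum X Y) Z.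
Proof.
apply/seteqP; split=> u.
  by move=> [x Xx [_ [y Yy [z Zz <-]] <-]]; exists (x + y); [exists x => //; exists y|exists z; rewrite ?addrA].
by move=> [_ [x Xx [y Yy <-]] [z Zz <-]]; exists x => //; exists (y + z); [exists y => //; exists z|rewrite addrA].
Qed.

Lemma convex_triangle X p q s (a c : R) : convex_set X -> X p -> X q -> X s ->
  0 <= a -> 0 <= c -> a + c <= 1 -> X (p + a *: (s - p) + c *: (q - p)).
Proof.
move=> /convex_setP vX Xp Xq Xs a0 c0 ac.
have [a1|a1] := eqVneq a 1.
  have -> : c = 0 by lra.
  have -> // : p + a *: (s - p) + 0 *: (q - p) = s.
  by rewrite a1; apply: pair_ext; rewrite /= /GRing.scale /=; ring.
have a1' : 0 < 1 - a by rewrite subr_gt0 lt_neqAle a1; lra.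
have Xz : X (p + (c / (1 - a)) *: (q - p)).
  apply: vX => //; apply/andP; split; first by rewrite divr_ge0// ltW.
  by rewrite ler_pdivrMr// mul1r; lra.
have a01 : 0 <= a <= 1 by lra.
have := vX _ _ a Xz Xs a01; congr X.
by apply: pair_ext; rewrite /= /GRing.scale /=; field; rewrite lt0r_neq0.
Qed.

Variable W : set (R * R).
Hypothesis cW : compact_convex W.
Hypothesis W0 : W !=set0.
Hypothesis symW : forall x, W x -> W (- x).

Local Notation V S := (vol (minkowski_sum W S)).

Let sum_compact S : compact_convex S -> compact (minkowski_sum W S).
Proof. by move=> cS; have [] := minkowski_sum_compact_convex cW cS. Qed.

Lemma vol_sum_cover S X Y Z : compact_convex X -> compact_convex Y ->
  compact_convex S -> compact_convex Z ->
  S `<=` X `|` Y -> Z `<=` X `&` Y -> V S + V Z <= V X + V Y.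
Proof.
move=> cX cY cS cZ SXY ZXY; rewrite -(volUI (sum_compact cX) (sum_compact cY)).
have cI : compact (minkowski_sum W X `&` minkowski_sum W Y).
  by apply: compactI2; exact: sum_compact.
have cU : compact (minkowski_sum W X `|` minkowski_sum W Y).
  by apply: compactU; exact: sum_compact.
apply: lerD; apply: le_vol => //; try exact: sum_compact.
  by move=> _ [w Ww [x /SXY [Xx|Yx] <-]]; [left|right]; exists w => //; exists x.
by move=> _ [w Ww [x /ZXY [Xx Yx] <-]]; split; exists w => //; exists x.
Qed.

(** Minkowski addition of a convex set is a valuation: of two points on
    different sides of a line, the convex combination of their summands along
    the segment joining them meets the line, so what the two parts of the sum
    have in common comes from the cut itself. *)
Lemma vol_sum_cut S f (c : R) : compact_convex S ->
  V (S `&` [set x | c <= dot f x]) + V (S `&` [set x | dot f x <= c]) <=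
  V S + V (S `&` [set x | dot f x = c]).
Proof.
move=> cS.
have cX := compact_convexI cS (halfplane_ge f c).
have cY := compact_convexI cS (halfplane_le f c).
have cZ := compact_convexI cS (line_closed_convex f c).
set X := S `&` _ in cX *; set Y := S `&` [set x | dot f x <= c] in cY *.
set Z := S `&` _ in cZ *.
have cI : compact (minkowski_sum W X `&` minkowski_sum W Y).
  by apply: compactI2; exact: sum_compact.
have cU : compact (minkowski_sum W X `|` minkowski_sum W Y).
  by apply: compactU; exact: sum_compact.
rewrite -(volUI (sum_compact cX) (sum_compact cY)).
apply: lerD; apply: le_vol => //; try exact: sum_compact.
  by move=> z [|] [w Ww [x [Sx _] <-]]; exists w => //; exists x.
move=> z [[w Ww [x [Sx /= fx] exz]] [w' Ww' [y [Sy /= fy] eyz]]].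
have [exc|nxc] := eqVneq (dot f x) c.
  by exists w => //; exists x.
have D0 : 0 < dot f x - dot f y.
  by rewrite subr_gt0 (le_lt_trans fy)// lt_neqAle eq_sym nxc.
pose s := (dot f x - c) / (dot f x - dot f y).
have s01 : 0 <= s <= 1.
  rewrite /s; apply/andP; split; first by rewrite divr_ge0 ?(ltW D0)// subr_ge0.
  by rewrite ler_pdivrMr// mul1r lerD2l lerN2.
exists (w + s *: (w' - w)); first exact: (convex_setP W).1 cW.2 _ _ _ Ww Ww' s01.
exists (x + s *: (y - x)).
  split; first exact: (convex_setP S).1 cS.2 _ _ _ Sx Sy s01.
  by rewrite /= dotD dotZ dotB /s; field; rewrite lt0r_neq0.
transitivity ((w + x) + s *: ((w' + y) - (w + x))).
  by apply: pair_ext; rewrite /= /GRing.scale /=; ring.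
by rewrite exz eyz subrr scaler0 addr0.
Qed.

(** This is where the symmetry of [W] enters: the reflected sum is again a sum
    with [W]. *)
Lemma vol_sum_reflection S p : compact_convex S -> V [set p - x | x in S] = V S.
Proof.
move=> cS.
have mS := compact_measurable2 (sum_compact cS).
have mO : measurable [set - x | x in minkowski_sum W S].
  apply: compact_measurable2; apply: continuous_image_compact; last exact: sum_compact.
  by move=> x; apply: cvgN; exact: cvg_id.
rewrite -(vol_opp mS) -(vol_translate p mO); congr vol.
apply/seteqP; split=> z /=.
  move=> [w Ww [_ [x Sx <-] <-]]; exists (- (- w + x)); last first.
    by apply: pair_ext => /=; ring.
  by exists (- w + x) => //; exists (- w); [exact: symW|exists x].
move=> [_ [_ [w Ww [x Sx <-]] <-] <-]; exists (- w); first exact: symW.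
by exists (p - x); [exists x|apply: pair_ext => /=; ring].
Qed.

Lemma vol_sum_segment p e : V (segment p e) = vol W + width W (perp e).
Proof. exact: vol_minkowski_segment. Qed.

(** Two copies of the triangle [p], [q = p + b *: d], [s], one reflected in the midpoint of
    [q] and [s], make up a parallelogram; the sum of [W] with a parallelogram
    is [W] swept along its two sides in turn. *)
Lemma vol_sum_triangle X d p s (b : R) : compact_convex X -> 0 <= b ->
  X p -> X (p + b *: d) -> X s -> `|dot (perp d) (s - p)| = width W (perp d) ->
  V (segment p (s - p)) + V (segment (p + b *: d) (s - (p + b *: d))) +
    2 * b * width W (perp d) <= 2 * V X.
Proof.
move=> cX b0 Xp Xq Xs ew.
set q := p + b *: d in Xq *.
(* the reflection in the midpoint of [q] and [s] *)
pose X' := [set (q + s) - x | x in X].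
pose P := minkowski_sum (segment p (s - p)) (segment 0 (b *: d)).
have cs a e := @segment_compact_convex R a e.
have cX' : compact_convex X'.
  rewrite (_ : X' = minkowski_sum (segment (q + s) 0) (linmap (-1, 0) (0, -1) @` X)).
    by apply: minkowski_sum_compact_convex => //; exact: linmap_compact_convex.
  apply/seteqP; split=> z /=.
    move=> [x Xx <-]; exists (q + s); first exact: segment_left.
    exists (- x) => //; exists x => //.
    by rewrite linmapE; apply: pair_ext => /=; ring.
  move=> [_ /segmentP[a _ ->] [_ [x Xx <-] <-]]; exists x => //.
  by rewrite linmapE; apply: pair_ext; rewrite /= /GRing.scale /=; ring.
have VX' : V X' = V X by exact: vol_sum_reflection.
have cP : compact_convex P by exact: minkowski_sum_compact_convex.
have VP : V P = V (segment p (s - p)) + 2 * b * width W (perp d).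
  rewrite /P minkowski_sumA vol_minkowski_segment; first last.
  - by have [w Ww] := W0; exists (w + p); exists w => //; exists p => //; exact: segment_left.
  - exact: minkowski_sum_compact_convex.
  have [w0 W00] := W0; have [c1 _] := cs p (s - p).
  congr (_ + _); rewrite perpZ widthZ//; [|by apply: sum_compact; exact: cs|]; last first.
    by exists (w0 + p); exists w0 => //; exists p => //; exact: segment_left.
  rewrite width_minkowski_sum//; [|exact: cW.1|exact: segment_neq0].
  by rewrite width_segment ew; ring.
have vX := (convex_setP X).1 cX.2.
have qp : b *: d = q - p by rewrite /q [p + _]addrC addrK.
have H : V P + V (segment q (s - q)) <= V X + V X'.
  apply: vol_sum_cover => //.
  - move=> _ [_ /segmentP[a /andP[a0 a1] ->] [_ /segmentP[c /andP[c0 c1] ->] <-]].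
    rewrite add0r qp; have [ac|ac] := leP (a + c) 1; [left|right].
      exact: convex_triangle cX.2 _ _ _ _ _ _.
    exists (p + (1 - a) *: (s - p) + (1 - c) *: (q - p)).
      apply: convex_triangle cX.2 _ _ _ _ _ _ => //; rewrite ?subr_ge0//.
      by rewrite addrACA -opprD lerBlDr -[1 + 1]/(2%:R) -natr1 lerD2l ltW.
    by apply: pair_ext; rewrite /= /GRing.scale /=; ring.
  - move=> _ /segmentP[a a01 ->].
    have a01' : 0 <= 1 - a <= 1.
      by have /andP[? ?] := a01; rewrite subr_ge0 lerBlDr lerDl; apply/andP.
    split; first exact: vX.
    exists (q + (1 - a) *: (s - q)); first exact: vX.
    by apply: pair_ext; rewrite /= /GRing.scale /=; ring.
rewrite VX' VP in H; rewrite [leRHS]mulr_natl mulr2n; apply: le_trans H.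
by rewrite -!addrA (addrC (2 * b * _)).
Qed.

(** A segment parallel to [d] is determined by the extremal values that [d],
    taken as a functional, has on it. *)
Lemma chord S d (c : R) : compact_convex S -> d != 0 ->
  S `&` [set x | dot (perp d) x = c] !=set0 ->
  exists p (b : R), 0 <= b /\ S `&` [set x | dot (perp d) x = c] = segment p (b *: d).
Proof.
move=> cS d0; set C := S `&` _ => C0.
have cC : compact_convex C := compact_convexI cS (line_closed_convex (perp d) c).
have [x [y [Cx Cy m]]] := dot_minmax d cC.1 C0.
pose N := dot d d.
have N0 : 0 < N by exact: dot_self_gt0.
have par z : C z -> z = x + (dot d (z - x) / N) *: d.
  move=> [_ /= fz]; have [_ /= fx] := Cx.
  have D0 : dot (perp d) (z - x) = 0 by rewrite dotB fz fx subrr.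
  have N0' := lt0r_neq0 N0.
  apply: pair_ext; rewrite /= /GRing.scale /= mulrAC.
    rewrite (_ : dot d (z - x) * d.1 = (z.1 - x.1) * N); first by rewrite mulfK// addrC subrK.
    transitivity (dot d (z - x) * d.1 - d.2 * dot (perp d) (z - x)); first by rewrite D0 mulr0 subr0.
    by rewrite /N /dot /perp /=; ring.
  rewrite (_ : dot d (z - x) * d.2 = (z.2 - x.2) * N); first by rewrite mulfK// addrC subrK.
  transitivity (dot d (z - x) * d.2 + d.1 * dot (perp d) (z - x)); first by rewrite D0 mulr0 addr0.
  by rewrite /N /dot /perp /=; ring.
exists x, (dot d (y - x) / N); split.
  by rewrite divr_ge0 ?(ltW N0)// dotB subr_ge0; have /andP[] := m _ Cy.
apply/seteqP; split=> z.
  move=> Cz; have /andP[xz zy] := m _ Cz.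
  rewrite (par _ Cz); have [dxy|dxy] := eqVneq (dot d (y - x)) 0.
    have -> : dot d (z - x) = 0 by move: dxy; rewrite !dotB; lra.
    by rewrite mul0r scale0r addr0; exact: segment_left.
  have dp : 0 < dot d (y - x) by rewrite lt_neqAle eq_sym dxy dotB subr_ge0 (le_trans xz).
  apply/segmentP; exists (dot d (z - x) / dot d (y - x)).
    rewrite divr_ge0 ?(ltW dp)//=; last by rewrite dotB subr_ge0.
    by rewrite ler_pdivrMr// mul1r !dotB lerD2r.
  congr (x + _); rewrite scalerA; congr (_ *: _).
  by field; rewrite dxy lt0r_neq0.
move=> /segmentP[s s01 ->].
have -> : x + s *: ((dot d (y - x) / N) *: d) = x + s *: (y - x).
  by rewrite {2}(par _ Cy) [x + _ *: d]addrC addrK.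
exact: (convex_setP C).1 cC.2 _ _ _ Cx Cy s01.
Qed.

Variable A : R.
Hypothesis widthA : forall f g, `|det2 f g| * A <= width W f * width W g.
Hypothesis width_gt0 : forall f, f != 0 -> 0 < width W f.

(** A segment crossing a strip of the width of [W] together with [W] has room
    for [A] besides [W]: the strip and the strip that [W] fills in the direction
    of the segment cut out a parallelogram around [W]. *)
Lemma vol_sum_crossing d p e : d != 0 -> `|dot (perp d) e| = width W (perp d) ->
  vol W + A <= V (segment p e).
Proof.
move=> d0 ew; rewrite vol_sum_segment lerD2l.
have w0 : 0 < width W (perp d).
  by apply: width_gt0; exact: perp_neq0.
have := widthA (perp d) (perp e).
rewrite (_ : `|det2 _ _| = width W (perp d)) ?ler_pM2l//.
by rewrite -ew /det2 /dot /perp /=; congr (`|_|); ring.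
Qed.

(** When an open strip of the width of [W] is removed from [S], the area of the
    sum with [W] drops by at least [A - vol W]. Between its two chords [S] contains a
    trapezoid, whose diagonal cuts it into two triangles; its two legs cross the
    strip. *)
Lemma vol_sum_strip S d (c1 c2 : R) : compact_convex S -> d != 0 ->
  c2 - c1 = width W (perp d) ->
  S `&` [set x | c2 <= dot (perp d) x] !=set0 ->
  S `&` [set x | dot (perp d) x <= c1] !=set0 ->
  V (S `&` [set x | c2 <= dot (perp d) x]) +
  V (S `&` [set x | dot (perp d) x <= c1]) + A <= V S + vol W.
Proof.
move=> cS d0 cw S20 S10.
set f := perp d in cw S10 S20 *.
have f0 : f != 0 by exact: perp_neq0.
have w0 := width_gt0 f0; set w := width W f in cw w0.
have c12 : c1 < c2 by lra.
have cross (c : R) : c1 <= c <= c2 -> S `&` [set x | dot f x = c] !=set0.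
  move=> cc; have [x [Sx /= fx]] := S20; have [y [Sy /= fy]] := S10.
  have D0 : 0 < dot f x - dot f y by lra.
  exists (x + ((dot f x - c) / (dot f x - dot f y)) *: (y - x)); split.
    apply: (convex_setP S).1 cS.2 _ _ _ Sx Sy _; apply/andP; split.
      by rewrite divr_ge0 ?(ltW D0)//; lra.
    by rewrite ler_pdivrMr// mul1r; lra.
  by rewrite /= dotD dotZ dotB; field; rewrite lt0r_neq0.
have [r [b1 [b10 ch1]]] : exists p (b : R), 0 <= b /\ S `&` [set x | dot f x = c1] = segment p (b *: d).
  by apply: chord => //; apply: cross; lra.
have [p [b2 [b20 ch2]]] : exists p (b : R), 0 <= b /\ S `&` [set x | dot f x = c2] = segment p (b *: d).
  by apply: chord => //; apply: cross; lra.
have Vch q (b : R) : 0 <= b -> V (segment q (b *: d)) = vol W + b * w.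
  by move=> b0; rewrite vol_sum_segment perpZ widthZ//; exact: cW.1.
pose q := p + b2 *: d; pose s := r + b1 *: d.
have inS z (c : R) (y : R * R) (b : R) : S `&` [set x | dot f x = c] = segment y (b *: d) ->
    z = y \/ z = y + b *: d -> S z /\ dot f z = c.
  move=> E H; have : segment y (b *: d) z by case: H => ->; [exact: segment_left|exact: segment_right].
  by rewrite -E => -[].
have [Sr fr] := inS r _ _ _ ch1 (or_introl erefl).
have [Ss fs] := inS s _ _ _ ch1 (or_intror erefl).
have [Sp fp] := inS p _ _ _ ch2 (or_introl erefl).
have [Sq fq] := inS q _ _ _ ch2 (or_intror erefl).
pose T := S `&` [set x | c1 <= dot f x].
have cT : compact_convex T := compact_convexI cS (halfplane_ge f c1).
pose M := T `&` [set x | dot f x <= c2].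
have cM : compact_convex M := compact_convexI cT (halfplane_le f c2).
have T2 : T `&` [set x | c2 <= dot f x] = S `&` [set x | c2 <= dot f x].
  apply/seteqP; split=> x /=; first by case=> -[].
  by case=> Sx fx; split => //; split => //=; exact: le_trans (ltW c12) fx.
have T3 : T `&` [set x | dot f x = c2] = segment p (b2 *: d).
  rewrite -ch2; apply/seteqP; split=> x /=; first by case=> -[].
  by case=> Sx fx; split => //; split => //=; rewrite fx ltW.
have Mr : M r by split; [split|] => //=; rewrite fr ?lexx// ltW.
have Ms : M s by split; [split|] => //=; rewrite fs ?lexx// ltW.
have Mp : M p by split; [split|] => //=; rewrite fp ?lexx// ltW.
have Mq : M q by split; [split|] => //=; rewrite fq ?lexx// ltW.
(* the diagonal of the trapezoid *)
pose g := perp (s - p).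
have fsp : dot f (s - p) = - w by rewrite dotB fs fp -cw opprB.
have frp : dot f (p - r) = w by rewrite dotB fr fp.
have gd : dot g d = w.
  have : dot g d = - dot f (s - p) by rewrite /g /f /dot /perp /=; ring.
  by rewrite fsp opprK.
have gs : dot g s = dot g p.
  by apply/eqP; rewrite -subr_eq0 -dotB /g dot_perp /det2; apply/eqP; ring.
have gq : dot g p <= dot g q by rewrite /q dotD dotZ gd lerDl mulr_ge0// ltW.
have gr : dot g r <= dot g p by rewrite -gs /s dotD dotZ gd lerDl mulr_ge0// ltW.
have cX : compact_convex (M `&` [set x | dot g p <= dot g x]) := compact_convexI cM (halfplane_ge g _).
have cY : compact_convex (M `&` [set x | dot g x <= dot g p]) := compact_convexI cM (halfplane_le g _).
have cZ : compact_convex (M `&` [set x | dot g x = dot g p]) := compact_convexI cM (line_closed_convex g _).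
have diag : V (M `&` [set x | dot g x = dot g p]) <= V (segment p (s - p)).
  apply: le_vol; [exact: sum_compact|apply: sum_compact; exact: segment_compact_convex|].
  apply: minkowski_sumS => x [[[_ /= fx1] /= fx2] /= gx].
  apply/segmentP; exists ((c2 - dot f x) / w).
    by rewrite divr_ge0 ?(ltW w0) ?subr_ge0//= ler_pdivrMr// mul1r -cw lerD2l lerN2.
  have w0' := lt0r_neq0 w0.
  pose k : R := (c2 - dot f x) / w; rewrite -/k.
  have kw : k * w = c2 - dot f x by rewrite /k divfK.
  pose v := x - p - k *: (s - p).
  have gv : dot g v = 0.
    by rewrite /v dotB dotZ !dotB gx gs !subrr mulr0 subr0.
  have fv : dot f v = 0.
    rewrite /v dotB dotZ !dotB fs fp (_ : c1 - c2 = - w); last by rewrite -cw opprB.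
    by rewrite mulrN kw; ring.
  have v0 : v = 0 by apply: (@perp_independent d (s - p)); rewrite // -/g gd.
  by move: v0; rewrite /v => /eqP; rewrite -addrA -opprD subr_eq0 => /eqP.
have H3 := vol_sum_cut g (dot g p) cM.
have H4 : V (segment p (s - p)) + V (segment q (s - q)) + 2 * b2 * w <=
    2 * V (M `&` [set x | dot g p <= dot g x]).
  apply: vol_sum_triangle => //.
  - by split => //=.
  - by split => //=; rewrite gs.
  - by rewrite -/f -/w fsp normrN gtr0_norm.
have H5 : V (segment r (p - r)) + V (segment s (p - s)) + 2 * b1 * w <=
    2 * V (M `&` [set x | dot g x <= dot g p]).
  apply: vol_sum_triangle => //.
  - by split => //=; rewrite gs.
  - by split => //=.
  - by rewrite -/f -/w frp gtr0_norm.
have sp : V (segment s (p - s)) = V (segment p (s - p)).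
  by rewrite !vol_sum_segment -(widthN _ cW.1 W0) -perpN opprB.
have Hq : vol W + A <= V (segment q (s - q)).
  by apply: (vol_sum_crossing _ d0); rewrite -/f -/w dotB fs fq -cw -opprB normrN gtr0_norm// subr_gt0.
have Hr : vol W + A <= V (segment r (p - r)).
  by apply: (vol_sum_crossing _ d0); rewrite -/f -/w frp gtr0_norm.
have H1 := vol_sum_cut f c1 cS.
rewrite -/T ch1 (Vch _ _ b10) in H1.
have H2 := vol_sum_cut f c2 cT.
rewrite -/M T2 T3 (Vch _ _ b20) in H2.
rewrite sp in H5.
move: H1 H2 H3 diag H4 H5 Hq Hr; clear; clearbody w.
by do ! (move: (vol _) => ?); lra.
Qed.

(** The points of [T] are the centres of translates of [W]: a line missing the
    interiors of the translates becomes a strip, of the width of [W], whose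
    interior misses [T]. *)
Definition separated_by_strips (T : seq (R * R)) : Prop :=
  forall x y, x \in T -> y \in T -> x != y ->
    exists d (c1 c2 : R), [/\ d != 0, c2 - c1 = width W (perp d),
      dot (perp d) x <= c1, c2 <= dot (perp d) y &
      forall z, z \in T -> dot (perp d) z <= c1 \/ c2 <= dot (perp d) z].

Lemma separated_subset (T T' : seq (R * R)) : {subset T' <= T} ->
  separated_by_strips T -> separated_by_strips T'.
Proof.
move=> TT sT x y xT yT xy.
have [d [c1 [c2 [d0 cw xc yc H]]]] := sT x y (TT _ xT) (TT _ yT) xy.
by exists d, c1, c2; split => // z /TT; exact: H.
Qed.

(** For a single point the inequality says that [S + W] contains a translate
    of [W]. *)
Lemma count_strip_separated S (T : seq (R * R)) : compact_convex S -> uniq T -> T != [::] ->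
  (forall x, x \in T -> S x) -> separated_by_strips T ->
  (size T)%:R * A + vol W <= V S + A.
Proof.
have [n] := ubnP (size T); elim: n S T => // n IH S T nT cS uT T0 TS sT.
case: T => [|x [|y T]] // in nT uT T0 TS sT *.
  rewrite mul1r addrC lerD2r.
  rewrite -(vol_translate x (compact_measurable2 cW.1)).
  apply: le_vol; last 1 first.
  - by move=> _ [w Ww <-]; exists w => //; exists x => //; apply: TS; rewrite inE.
  - rewrite (_ : translate W x = minkowski_sum W (segment x 0)).
      by apply: sum_compact; exact: segment_compact_convex.
    apply/seteqP; split=> z /=.
      by move=> [w Ww <-]; exists w => //; exists x => //; exact: segment_left.
    by move=> [w Ww [_ /segmentP[a _ ->] <-]]; exists w; rewrite // scaler0 addr0.
  - exact: sum_compact.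
have xT : x \in [:: x, y & T] by rewrite inE eqxx.
have yT : y \in [:: x, y & T] by rewrite !inE eqxx orbT.
have xy : x != y by move: uT; rewrite /= inE negb_or => /andP[/andP[]].
have [d [c1 [c2 [d0 cw xc yc H]]]] := sT x y xT yT xy.
set U := [:: x, y & T] in xT yT nT uT TS sT H *.
set f := perp d in cw xc yc H.
have f0 : f != 0 by exact: perp_neq0.
have w0 := width_gt0 f0.
pose T1 := [seq z <- U | dot f z <= c1].
pose T2 := [seq z <- U | c2 <= dot f z].
have sz : (size U = size T1 + size T2)%N.
  rewrite !size_filter -(count_predC [pred z | dot f z <= c1]); congr (_ + _)%N.
  apply: eq_in_count => z zU /=; have [zl|zh] := H z zU.
    by rewrite zl /=; symmetry; apply/negbTE; rewrite -ltNge; lra.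
  by rewrite zh -ltNge; lra.
have xT1 : x \in T1 by rewrite mem_filter xc.
have yT2 : y \in T2 by rewrite mem_filter yc.
have sub1 : {subset T1 <= U} by move=> z; rewrite mem_filter => /andP[].
have sub2 : {subset T2 <= U} by move=> z; rewrite mem_filter => /andP[].
have s1 : (0 < size T1)%N by case: (T1) xT1.
have s2 : (0 < size T2)%N by case: (T2) yT2.
have I1 : (size T1)%:R * A + vol W <= V (S `&` [set z | dot f z <= c1]) + A.
  apply: IH.
  - by apply: leq_trans (nT : (size U <= n)%N); rewrite sz -addn1 leq_add2l.
  - exact: compact_convexI cS (halfplane_le f c1).
  - exact: filter_uniq.
  - by rewrite -size_eq0 -lt0n.
  - by move=> z; rewrite mem_filter => /andP[? ?]; split => //; exact: TS.
  - exact: separated_subset sT.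
have I2 : (size T2)%:R * A + vol W <= V (S `&` [set z | c2 <= dot f z]) + A.
  apply: IH.
  - by apply: leq_trans (nT : (size U <= n)%N); rewrite sz -add1n leq_add2r.
  - exact: compact_convexI cS (halfplane_ge f c2).
  - exact: filter_uniq.
  - by rewrite -size_eq0 -lt0n.
  - by move=> z; rewrite mem_filter => /andP[? ?]; split => //; exact: TS.
  - exact: separated_subset sT.
have H3 : V (S `&` [set x | c2 <= dot f x]) + V (S `&` [set x | dot f x <= c1]) + A <= V S + vol W.
  apply: vol_sum_strip => //; first by exists y; split => //; exact: TS.
  by exists x; split => //; exact: TS.
rewrite sz natrD mulrDl; move: I1 I2 H3; clear.
by do ! (move: (vol _) => ?); lra.
Qed.

End strip_separation.

(** * Circumscribed parallelograms *)

Section circumscribed.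
Variable R : realType.
Implicit Types (X K P : set (R * R)) (d f g p u v x y z t : R * R).

Lemma le_width X f x y : compact X -> X x -> X y -> dot f x - dot f y <= width X f.
Proof.
move=> cX Xx Xy; have X0 : X !=set0 by exists x.
have [a [b [Xa Xb m]]] := dot_minmax f cX X0.
rewrite (widthE Xa Xb m).
have /andP[_ ?] := m _ Xx; have /andP[? _] := m _ Xy; exact: lerB.
Qed.

Lemma interior_ball X x : X° x <-> exists2 e : R, 0 < e & ball x e `<=` X.
Proof. exact: nbhs_ballP. Qed.

Lemma width_gt0 X f : compact X -> X° !=set0 -> f != 0 -> 0 < width X f.
Proof.
move=> cX [z /interior_ball [e e0 eX]] f0.
have nf0 : 0 < `|f| by rewrite normr_gt0.
pose s := e / (2 * `|f|); have s0 : 0 < s by rewrite divr_gt0// mulr_gt0.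
have Xz : X z by apply: eX; exact: ballxx.
have Xs : X (z + s *: f).
  apply: eX; rewrite -ball_normE /= opprD addNKr normrN normrZ gtr0_norm//.
  by rewrite /s invfM mulrA mulfVK ?lt0r_neq0// ltr_pdivrMr// ltr_pMr// ltr1n.
apply: lt_le_trans (le_width f cX Xs Xz).
by rewrite dotD dotZ addrAC subrr add0r mulr_gt0// dot_self_gt0.
Qed.

Lemma vol_unit_square : vol (`[0, 1]%classic `*` `[0, 1]%classic : set (R * R)) = 1.
Proof.
have mI : measurable (`[0, 1]%classic : set R) by exact: measurable_itv.
have E : lebesgue_measure (`[0, 1]%classic : set R) = 1%E.
  by rewrite lebesgue_measure_itv /= lte_fin ltr01 oppr0 addr0.
by rewrite /vol areaX// E mule1.
Qed.

Lemma parallelogramE p u v : parallelogram p u v =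
  translate (linmap u v @` (`[0, 1]%classic `*` `[0, 1]%classic)) p.
Proof.
apply/seteqP; split=> x /=.
  move=> [s [t [s01 t01 ->]]]; exists (linmap u v (s, t)).
    by exists (s, t) => //; split; rewrite /= in_itv.
  by rewrite /linmap /= addrC addrA.
move=> [_ [[s t] [/= s01 t01] <-] <-]; rewrite !in_itv /= in s01 t01.
by exists s, t; split => //; rewrite /linmap /= addrC addrA.
Qed.

Lemma parallelogram_compact p u v : compact (parallelogram p u v).
Proof.
rewrite parallelogramE; apply: continuous_image_compact.
  by move=> x; apply: cvgD; [exact: cvg_id|exact: cvg_cst].
apply: continuous_image_compact; first exact: linmap_continuous.
by apply: compact_setX; exact: segment_compact.
Qed.

Lemma vol_parallelogram p u v : det2 u v != 0 -> vol (parallelogram p u v) = `|det2 u v|.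
Proof.
move=> D0; rewrite parallelogramE.
have cQ : compact (`[0, 1]%classic `*` `[0, 1]%classic : set (R * R)).
  by apply: compact_setX; exact: segment_compact.
rewrite vol_translate; last first.
  by apply: compact_measurable2; apply: continuous_image_compact => //; exact: linmap_continuous.
by rewrite vol_linmap// vol_unit_square mulr1.
Qed.

Lemma area_parallelogram p u v : det2 u v != 0 ->
  area (parallelogram p u v) = `|det2 u v|%:E.
Proof.
by move=> D0; rewrite (area_compact (@parallelogram_compact p u v)) vol_parallelogram.
Qed.

(** A parallelogram is the intersection of two strips; it is circumscribed
    about [K] when these strips have the width of [K]. *)
Lemma circumscribed_strips K P : circumscribed_parallelogram K P ->
  exists f g, [/\ det2 f g != 0, width K f = 1, width K g = 1 &
    area P = (`|det2 f g|^-1)%:E].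
Proof.
move=> [p [u [v [D0 -> KP [Kg0 Kg1 Kf0 Kf1]]]]].
rewrite -/(det2 u v) in D0.
pose f := ((det2 u v)^-1 * v.2, - ((det2 u v)^-1 * v.1)).
pose g := (- ((det2 u v)^-1 * u.2), (det2 u v)^-1 * u.1).
have fE (s t : R) : dot f (p + s *: u + t *: v) = dot f p + s.
  rewrite !dotD !dotZ -addrA; congr (_ + _).
  by rewrite /f /dot /det2 /= in D0 *; field.
have gE (s t : R) : dot g (p + s *: u + t *: v) = dot g p + t.
  rewrite !dotD !dotZ -addrA; congr (_ + _).
  by rewrite /g /dot /det2 /= in D0 *; field.
have dE : det2 f g = (det2 u v)^-1.
  by rewrite /f /g /det2 /= in D0 *; field.
have fK z : K z -> dot f p <= dot f z <= dot f p + 1.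
  by move=> /KP [s [t [s01 _ ->]]]; rewrite fE lerDl lerD2l.
have gK z : K z -> dot g p <= dot g z <= dot g p + 1.
  by move=> /KP [s [t [_ t01 ->]]]; rewrite gE lerDl lerD2l.
exists f, g; split.
- by rewrite dE invr_eq0.
- have [x [/segmentP[a _ ex] Kx]] := Kf0; have [y [/segmentP[b _ ey] Ky]] := Kf1.
  have fx : dot f x = dot f p.
    by rewrite ex -[p in p + a *: v]addr0 -(scale0r u) fE addr0.
  have fy : dot f y = dot f p + 1 by rewrite ey -[u in p + u]scale1r fE.
  rewrite (widthE Kx Ky) ?fx ?fy; first by rewrite addrAC subrr add0r.
  exact: fK.
- have [x [/segmentP[a _ ex] Kx]] := Kg0; have [y [/segmentP[b _ ey] Ky]] := Kg1.
  have gx : dot g x = dot g p.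
    by rewrite ex -[p + _]addr0 -(scale0r v) gE addr0.
  have gy : dot g y = dot g p + 1 by rewrite ey addrAC -[v in _ + v]scale1r gE.
  rewrite (widthE Kx Ky) ?gx ?gy; first by rewrite addrAC subrr add0r.
  exact: gK.
- by rewrite area_parallelogram// dE normfV invrK.
Qed.

Lemma strips_circumscribed K f g : compact K -> K° !=set0 -> det2 f g != 0 ->
  exists P, circumscribed_parallelogram K P /\
    area P = (width K f * width K g / `|det2 f g|)%:E.
Proof.
move=> cK iK D0.
have K0 : K !=set0 by have [x /interior_subset] := iK; exists x.
have f0 : f != 0 by apply: contra_neq D0 => ->; rewrite /det2 /= !mul0r subrr.
have g0 : g != 0 by apply: contra_neq D0 => ->; rewrite /det2 /= !mulr0 subrr.
have wf0 := width_gt0 cK iK f0; have wg0 := width_gt0 cK iK g0.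
have [a [b [Ka Kb fm]]] := dot_minmax f cK K0.
have [a' [b' [Ka' Kb' gm]]] := dot_minmax g cK K0.
have wfE := widthE Ka Kb fm; have wgE := widthE Ka' Kb' gm.
set wf := width K f in wf0 wfE *; set wg := width K g in wg0 wgE *.
pose D := det2 f g.
pose u0 := (g.2 / D, - g.1 / D); pose v0 := (- f.2 / D, f.1 / D).
pose p := dot f a *: u0 + dot g a' *: v0.
have repr z : z = p + ((dot f z - dot f a) / wf) *: (wf *: u0) + ((dot g z - dot g a') / wg) *: (wg *: v0).
  rewrite !scalerA !divfK ?lt0r_neq0// /p.
  apply: pair_ext; rewrite /= /GRing.scale /=;
  rewrite /D /dot /det2 in D0 *; field; exact: D0.
have detE : det2 (wf *: u0) (wg *: v0) = wf * wg / D.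
  rewrite -/D in D0; transitivity (wf * wg * D / (D * D)); last by field.
  rewrite [in X in _ = X / _]/D {1}/det2 /u0 /v0 /det2 /= /GRing.scale /=.
  by field.
have det0 : det2 (wf *: u0) (wg *: v0) != 0.
  by rewrite detE mulf_neq0 ?invr_eq0// mulf_neq0 ?lt0r_neq0.
have f01 z : K z -> 0 <= (dot f z - dot f a) / wf <= 1.
  move=> /fm/andP[az zb]; rewrite divr_ge0 ?(ltW wf0) ?subr_ge0//=.
  by rewrite ler_pdivrMr// mul1r wfE lerD2r.
have g01 z : K z -> 0 <= (dot g z - dot g a') / wg <= 1.
  move=> /gm/andP[az zb]; rewrite divr_ge0 ?(ltW wg0) ?subr_ge0//=.
  by rewrite ler_pdivrMr// mul1r wgE lerD2r.
have fa : (dot f a - dot f a) / wf = 0 by rewrite subrr mul0r.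
have ga : (dot g a' - dot g a') / wg = 0 by rewrite subrr mul0r.
have fb : (dot f b - dot f a) / wf = 1 by rewrite -wfE divff// lt0r_neq0.
have gb : (dot g b' - dot g a') / wg = 1 by rewrite -wgE divff// lt0r_neq0.
exists (parallelogram p (wf *: u0) (wg *: v0)); split; last first.
  rewrite area_parallelogram// detE normrM normfV ger0_norm//.
  by rewrite mulr_ge0// ltW.
exists p, (wf *: u0), (wg *: v0); split => //.
  move=> z Kz; exists ((dot f z - dot f a) / wf), ((dot g z - dot g a') / wg).
  by split; [exact: f01|exact: g01|exact: repr].
split.
- exists a'; split => //; apply/segmentP; exists ((dot f a' - dot f a) / wf); first exact: f01.
  by rewrite {1}(repr a') ga scale0r addr0.
- exists b'; split => //; apply/segmentP; exists ((dot f b' - dot f a) / wf); first exact: f01.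
  by rewrite {1}(repr b') gb scale1r addrAC.
- exists a; split => //; apply/segmentP; exists ((dot g a - dot g a') / wg); first exact: g01.
  by rewrite {1}(repr a) fa scale0r addr0.
- exists b; split => //; apply/segmentP; exists ((dot g b - dot g a') / wg); first exact: g01.
  by rewrite {1}(repr b) fb scale1r.
Qed.

Lemma det2_continuous : continuous (fun fg : (R * R) * (R * R) => det2 fg.1 fg.2).
Proof.
move=> fg.
have c11 : (fun x : (R * R) * (R * R) => x.1.1) @ fg --> fg.1.1.
  by apply: (@cvg_comp _ _ _ fst fst); [exact: cvg_fst|exact: cvg_fst].
have c12 : (fun x : (R * R) * (R * R) => x.1.2) @ fg --> fg.1.2.
  by apply: (@cvg_comp _ _ _ fst snd); [exact: cvg_fst|exact: cvg_snd].
have c21 : (fun x : (R * R) * (R * R) => x.2.1) @ fg --> fg.2.1.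
  by apply: (@cvg_comp _ _ _ snd fst); [exact: cvg_snd|exact: cvg_fst].
have c22 : (fun x : (R * R) * (R * R) => x.2.2) @ fg --> fg.2.2.
  by apply: (@cvg_comp _ _ _ snd snd); [exact: cvg_snd|exact: cvg_snd].
by apply: cvgB; apply: cvgM.
Qed.

Lemma box_compact (B : R) (X : set (R * R)) : closed X ->
  (forall x, X x -> `|x.1| <= B /\ `|x.2| <= B) -> compact X.
Proof.
move=> cX XB; apply: (@subclosed_compact _ X (`[-B, B]%classic `*` `[-B, B]%classic)) => //.
  by apply: compact_setX; exact: segment_compact.
by move=> x /XB [x1 x2]; split; rewrite /= in_itv /= -ler_norml.
Qed.

(** The functionals of width at most [1] on [K] form the polar of [K - K], which
    is compact; a pair of largest determinant cuts out the smallest parallelogram. *)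
Lemma min_parallelogram K : compact K -> K° !=set0 ->
  exists A : R, [/\ 0 < A,
    forall f g, `|det2 f g| * A <= width K f * width K g,
    exists P, min_area_circumscribed_parallelogram K P &
    forall P, min_area_circumscribed_parallelogram K P -> area P = A%:E].
Proof.
move=> cK iK.
have K0 : K !=set0 by have [x /interior_subset] := iK; exists x.
pose N : set (R * R) := [set f | forall x y, K x -> K y -> dot f (x - y) <= 1].
have dotC f x : dot f x = dot x f by rewrite /dot; ring.
have N_width f : N f <-> width K f <= 1.
  split=> [Nf|wf x y Kx Ky].
    have [a [b [Ka Kb fm]]] := dot_minmax f cK K0.
    by rewrite (widthE Ka Kb fm) -dotB; exact: Nf.
  by rewrite dotB; apply: le_trans wf; exact: le_width.
have clN : closed N.
  rewrite (_ : N = \bigcap_(xy in K `*` K) [set f | dot (xy.1 - xy.2) f <= 1]).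
    by apply: closed_bigI => xy _; have [] := halfplane_le (xy.1 - xy.2) 1.
  apply/seteqP; split=> f /=.
    by move=> Nf [x y] [/= Kx Ky]; rewrite -dotC; exact: Nf.
  by move=> Nf x y Kx Ky; rewrite dotC; exact: (Nf (x, y)).
have cN : compact N.
  have [z /interior_ball [e e0 eK]] := iK.
  have Kz : K z by apply: eK; exact: ballxx.
  have e2 : 0 < e / 2 by rewrite divr_gt0.
  apply: (@box_compact (e / 2)^-1) => // f Nf.
  have bound h : `|h| <= 1 -> dot f h <= (e / 2)^-1.
    move=> h1; rewrite -[leRHS]mul1r ler_pdivlMr// mulrC -dotZ.
    have Kh : K (z + (e / 2) *: h).
      apply: eK; rewrite -ball_normE /= opprD addNKr normrN normrZ gtr0_norm//.
      apply: (@le_lt_trans _ _ (e / 2)); last by rewrite ltr_pdivrMr// ltr_pMr// ltr1n.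
      by rewrite ler_piMr// ltW.
    by have := Nf _ _ Kh Kz; rewrite addrAC subrr add0r.
  have n1 (a b : R) : `|a| <= 1 -> `|b| <= 1 -> `|(a, b)| <= 1.
    by move=> a1 b1; rewrite prod_normE /= ge_max a1.
  have one : `|1 : R| <= 1 by rewrite normr1.
  have zer : `|0 : R| <= 1 by rewrite normr0 ler01.
  have mone : `|- (1 : R)| <= 1 by rewrite normrN.
  split; rewrite ler_norml; apply/andP; split.
  - rewrite lerNl; have := bound _ (n1 _ _ mone zer).
    by rewrite /dot /= mulr0 addr0 mulrN1.
  - by have := bound _ (n1 _ _ one zer); rewrite /dot /= mulr0 addr0 mulr1.
  - rewrite lerNl; have := bound _ (n1 _ _ zer mone).
    by rewrite /dot /= mulr0 add0r mulrN1.
  - by have := bound _ (n1 _ _ zer one); rewrite /dot /= mulr0 add0r mulr1.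
have N0 : N 0 by move=> x y _ _; rewrite dotC dot0 ler01.
have w0 h : 0 <= width K h.
  by have [x Kx] := K0; rewrite (le_trans _ (le_width h cK Kx Kx))// subrr.
have NN0 : N `*` N !=set0 by exists (0, 0).
have [[f0 g0] /set_mem[/= Nf0 Ng0] fgmax] := compact_EVT_max NN0 (compact_setX cN cN)
  (continuous_subspaceT det2_continuous).
pose D := det2 f0 g0.
have Dmax f g : N f -> N g -> det2 f g <= D.
  by move=> Nf Ng; apply: (fgmax (f, g)); rewrite inE.
have NM f : N f -> N (- f).
  move=> Nf x y Kx Ky; rewrite dotC dotN -dotC -dotN opprB; exact: Nf.
have Dmax' f g : N f -> N g -> `|det2 f g| <= D.
  move=> Nf Ng; rewrite ler_norml Dmax// andbT lerNl.
  rewrite (_ : - det2 f g = det2 (- f) g); first by apply: Dmax => //; exact: NM.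
  by rewrite /det2 /=; ring.
have scaled f g : f != 0 -> g != 0 -> `|det2 f g| <= D * (width K f * width K g).
  move=> fn0 gn0; have wf := width_gt0 cK iK fn0; have wg := width_gt0 cK iK gn0.
  have Nsc h : h != 0 -> N ((width K h)^-1 *: h).
    move=> hn0; have wh := width_gt0 cK iK hn0.
    apply/N_width; rewrite widthZ//; last by rewrite invr_ge0 ltW.
    by rewrite mulVf ?lexx// lt0r_neq0.
  have := Dmax' _ _ (Nsc _ fn0) (Nsc _ gn0).
  rewrite (_ : det2 _ _ = (width K f * width K g)^-1 * det2 f g); last first.
    by rewrite invfM /det2 /= /GRing.scale /=; ring.
  have ww : 0 < width K f * width K g by exact: mulr_gt0.
  by rewrite normrM gtr0_norm ?invr_gt0// mulrC ler_pdivrMr.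
have D0 : 0 < D.
  have e1 : (1, 0) != 0 :> R * R by apply/eqP => -[/eqP]; rewrite oner_eq0.
  have e2 : (0, 1) != 0 :> R * R by apply/eqP => -[/eqP]; rewrite oner_eq0.
  have := scaled _ _ e1 e2.
  have ww : 0 < width K (1, 0) * width K (0, 1) by rewrite mulr_gt0// width_gt0.
  rewrite (_ : `|_| = 1); last by rewrite /det2 /= mul0r subr0 mulr1 normr1.
  by move=> h; rewrite -(pmulr_lgt0 _ ww); apply: lt_le_trans h; exact: ltr01.
have D00 : det2 f0 g0 != 0 by rewrite lt0r_neq0.
have [P0 [cP0 aP0]] := strips_circumscribed cK iK D00.
have lower Q : circumscribed_parallelogram K Q -> ((D^-1)%:E <= area Q)%E.
  move=> /circumscribed_strips [f [g [fg wf wg ->]]]; rewrite lee_fin.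
  rewrite lef_pV2 ?posrE ?normr_gt0//; apply: Dmax'; apply/N_width; rewrite ?wf ?wg //.
have aP0' : area P0 = (D^-1)%:E.
  apply/eqP; rewrite eq_le lower// andbT aP0 lee_fin -/D gtr0_norm//.
  rewrite ler_pdivrMr// mulVf ?lt0r_neq0//.
  by apply: mulr_ile1 => //; apply/N_width.
exists D^-1; split.
- by rewrite invr_gt0.
- move=> f g; have [->|fn0] := eqVneq f 0.
    rewrite (_ : det2 0 g = 0) ?normr0 ?mul0r; last by rewrite /det2 /= !mul0r subrr.
    exact: mulr_ge0.
  have [->|gn0] := eqVneq g 0.
    rewrite (_ : det2 f 0 = 0) ?normr0 ?mul0r; last by rewrite /det2 /= !mulr0 subrr.
    exact: mulr_ge0.
  by rewrite ler_pdivrMr// mulrC; exact: scaled.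
- by exists P0; split => // Q /lower; rewrite aP0'.
- move=> P [cP Pmin]; apply/eqP; rewrite eq_le lower// andbT -aP0'.
  exact: Pmin.
Qed.

End circumscribed.

(** * Disks, and bodies missed by a line *)

Section disks.
Variable R : realType.
Implicit Types (X : set (R * R)) (x y : R * R) (a b r : R).

Definition disk r : set (R * R) := [set x | x.1 ^+ 2 + x.2 ^+ 2 <= r ^+ 2].

(** The triangle inequality for the Euclidean norm, by way of Lagrange's
    identity. *)
Lemma disk_add a b x y : 0 <= a -> 0 <= b -> disk a x -> disk b y ->
  disk (a + b) (x + y).
Proof.
move=> a0 b0; rewrite /disk /= => xa yb.
set p := x.1 * y.1 + x.2 * y.2.
have pab : p <= a * b.
  apply: le_trans (ler_norm p) _.
  rewrite -(ger0_norm (mulr_ge0 a0 b0)) -ler_sqr ?nnegrE// !real_normK ?num_real//.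
  apply: (@le_trans _ _ ((x.1 ^+ 2 + x.2 ^+ 2) * (y.1 ^+ 2 + y.2 ^+ 2))).
    rewrite -subr_ge0 (_ : _ - _ = (x.1 * y.2 - x.2 * y.1) ^+ 2) ?sqr_ge0//.
    by rewrite /p; ring.
  by rewrite exprMn ler_pM// addr_ge0 ?sqr_ge0.
rewrite (_ : _ + _ = (x.1 ^+ 2 + x.2 ^+ 2) + (y.1 ^+ 2 + y.2 ^+ 2) + 2 * p); last first.
  by rewrite /p; ring.
rewrite (_ : (a + b) ^+ 2 = a ^+ 2 + b ^+ 2 + 2 * (a * b)); last by ring.
by rewrite !lerD// ler_pM2l.
Qed.

Lemma disk_scale a r x : disk r x -> disk (a * r) (a *: x).
Proof.
rewrite /disk /= /GRing.scale /= !exprMn -mulrDr => h.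
by rewrite ler_wpM2l// sqr_ge0.
Qed.

Lemma disk_opp r x : disk r x -> disk r (- x).
Proof. by rewrite /disk /= !sqrrN. Qed.

Lemma compact_sub_disk X : compact X -> exists2 r : R, 0 < r & X `<=` disk r.
Proof.
move=> /compact_box [M M0 XM]; exists (2 * M); first by rewrite mulr_gt0.
move=> x /XM []; rewrite /disk /= !in_itv /= => /andP[? ?] /andP[? ?]; nra.
Qed.

Lemma disk_compact_convex r : 0 <= r -> compact_convex (disk r).
Proof.
move=> r0; split.
  apply: (@box_compact _ r).
    apply: (@preimage_closed _ _ (fun x : R * R => x.1 ^+ 2 + x.2 ^+ 2) [set t | t <= r ^+ 2]).
      move=> x _; apply: cvgD; rewrite expr2; apply: cvgM;
        by [exact: cvg_fst|exact: cvg_snd].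
    exact: closed_le.
  move=> x; rewrite /disk /= => h.
  have x1 : 0 <= x.1 ^+ 2 by exact: sqr_ge0.
  have x2 : 0 <= x.2 ^+ 2 by exact: sqr_ge0.
  split; rewrite -ler_sqr ?nnegrE// real_normK ?num_real//.
    by apply: le_trans h; rewrite lerDl.
  by apply: le_trans h; rewrite lerDr.
apply/convex_setP => x y s xr yr /andP[s0 s1].
have s1' : 0 <= 1 - s by rewrite subr_ge0.
rewrite (_ : x + _ = (1 - s) *: x + s *: y); last first.
  by apply: pair_ext; rewrite /= /GRing.scale /=; ring.
rewrite (_ : r = (1 - s) * r + s * r); last by ring.
by apply: disk_add; rewrite ?mulr_ge0//; exact: disk_scale.
Qed.

Lemma dilate_unit_disk r : 0 < r -> dilate r (@unit_disk R) = disk r.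
Proof.
move=> r0; apply/seteqP; split=> x /=.
  move=> [y y1 <-]; rewrite -[r in disk r]mulr1; apply: disk_scale.
  by rewrite /disk /= expr1n.
move=> xr; exists (r^-1 *: x); last by rewrite scalerA divff ?scale1r// lt0r_neq0.
have := disk_scale r^-1 xr.
by rewrite mulVf ?lt0r_neq0// /disk /= expr1n.
Qed.

Lemma vol_disk r : 0 < r -> vol (disk r) = r ^+ 2 * vol (disk 1).
Proof.
move=> r0; have D : det2 (r, 0) (0, r) = r ^+ 2 by rewrite /det2 /= mul0r subr0 expr2.
have D0 : det2 (r, 0) (0, r) != 0 by rewrite D sqrf_eq0 lt0r_neq0.
have [c1 _] := disk_compact_convex (@ler01 R).
rewrite (_ : disk r = linmap (r, 0) (0, r) @` (disk 1)).
  by rewrite (vol_linmap D0 c1) D ger0_norm// sqr_ge0.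
rewrite -(dilate_unit_disk r0) (_ : @unit_disk R = disk 1); last first.
  by apply/seteqP; split=> x; rewrite /unit_disk /disk /= expr1n.
by apply: eq_imagel => x _; rewrite linmapE; apply: pair_ext; rewrite /= /GRing.scale /=; ring.
Qed.

Lemma vol_unit_disk_gt0 : 0 < vol (disk 1).
Proof.
have D : det2 (2^-1, 0) (0, 2^-1) = 4^-1 :> R by rewrite /det2 /=; field.
have D0 : det2 (2^-1, 0) (0, 2^-1) != 0 :> R by rewrite D invr_eq0 pnatr_eq0.
have cQ : compact (`[0, 1]%classic `*` `[0, 1]%classic : set (R * R)).
  by apply: compact_setX; exact: segment_compact.
have := vol_linmap D0 cQ.
rewrite vol_unit_square D mulr1 => E.
apply: (@lt_le_trans _ _ `|4^-1|); first by rewrite normr_gt0 invr_eq0 pnatr_eq0.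
rewrite -E; apply: le_vol.
- by apply: continuous_image_compact => //; exact: linmap_continuous.
- by have [] := disk_compact_convex (@ler01 R).
- move=> _ [[x y] [/= hx hy] <-]; rewrite linmapE /disk /=.
  move: hx hy; rewrite !in_itv /= => /andP[? ?] /andP[? ?]; nra.
Qed.

End disks.

Section sides.
Variable R : realType.
Implicit Types (X K : set (R * R)) (d f p e t x y z : R * R).

(** The homothety with centre [x] and ratio [1 - s] maps a ball around [z]
    inside [X] to a ball inside [X]. *)
Lemma interior_convex X x z (s : R) : convex_set X -> X° z -> X x -> 0 <= s < 1 ->
  X° (z + s *: (x - z)).
Proof.
move=> /convex_setP vX /interior_ball [e e0 eX] Xx /andP[s0 s1].
have s1' : 0 < 1 - s by rewrite subr_gt0.
apply/interior_ball; exists ((1 - s) * e); first by rewrite mulr_gt0.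
move=> w; rewrite -ball_normE /= => hw.
have -> : w = (1 - s)^-1 *: (w - s *: x) + s *: (x - (1 - s)^-1 *: (w - s *: x)).
  by apply: pair_ext; rewrite /= /GRing.scale /=; field; rewrite lt0r_neq0.
apply: vX => //; last by rewrite s0 ltW.
apply: eX; rewrite -ball_normE /=.
rewrite (_ : z - _ = (1 - s)^-1 *: (z + s *: (x - z) - w)); last first.
  by apply: pair_ext; rewrite /= /GRing.scale /=; field; rewrite lt0r_neq0.
by rewrite normrZ gtr0_norm ?invr_gt0// mulrC ltr_pdivrMr// mulrC.
Qed.

(** Otherwise a segment from an interior point to a point beyond the line would
    meet the line in an interior point. *)
Lemma one_side X f (c : R) : convex_set X -> X° !=set0 ->
  (forall x, X° x -> dot f x != c) ->
  (forall x, X x -> dot f x <= c) \/ (forall x, X x -> c <= dot f x).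
Proof.
move=> vX [z iz] miss.
have cross x (s : R) : X x -> 0 <= s < 1 -> dot f (z + s *: (x - z)) != c.
  by move=> Xx s01; apply: miss; exact: interior_convex.
have := miss _ iz; rewrite neq_lt => /orP[zc|zc]; [left|right] => x Xx; rewrite leNgt; apply/negP => xc.
  have D0 : 0 < dot f x - dot f z by lra.
  have := cross x ((c - dot f z) / (dot f x - dot f z)) Xx.
  rewrite divr_ge0 ?(ltW D0) ?subr_ge0 ?(ltW zc)//= ltr_pdivrMr// mul1r ltrD2r xc => /(_ isT).
  by rewrite dotD dotZ dotB divfK ?lt0r_neq0// addrC subrK eqxx.
have D0 : 0 < dot f z - dot f x by lra.
have := cross x ((dot f z - c) / (dot f z - dot f x)) Xx.
rewrite divr_ge0 ?(ltW D0) ?subr_ge0 ?(ltW zc)//= ltr_pdivrMr// mul1r ltrD2l ltrN2 xc => /(_ isT).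
rewrite dotD dotZ dotB (_ : _ + _ = c) ?eqxx//.
by field; rewrite lt0r_neq0.
Qed.

(** From an interior point on the line one could move to both sides along the
    normal [f]. *)
Lemma interior_off_line X f (c : R) : f != 0 ->
  (forall x, X x -> dot f x <= c) \/ (forall x, X x -> c <= dot f x) ->
  forall x, X° x -> dot f x != c.
Proof.
move=> f0 side x /interior_ball [e e0 eX]; apply/eqP => fx.
have nf0 : 0 < `|f| by rewrite normr_gt0.
pose s := e / (2 * `|f|); have s0 : 0 < s by rewrite divr_gt0// mulr_gt0.
have se : `|s *: f| < e.
  by rewrite normrZ gtr0_norm// /s invfM mulrA mulfVK ?lt0r_neq0// ltr_pdivrMr// ltr_pMr// ltr1n.
have Xp : X (x + s *: f) by apply: eX; rewrite -ball_normE /= opprD addNKr normrN.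
have Xm : X (x - s *: f) by apply: eX; rewrite -ball_normE /= opprB addrC subrK.
have sff : 0 < s * dot f f by rewrite mulr_gt0// dot_self_gt0.
case: side => side; [have := side _ Xp|have := side _ Xm].
  by rewrite dotD dotZ fx; lra.
by rewrite dotB dotZ fx; lra.
Qed.

Lemma translateP K t x : translate K t x <-> K (x - t).
Proof.
split; first by move=> [y Ky <-]; rewrite addrK.
by move=> Kx; exists (x - t); rewrite ?subrK.
Qed.

Lemma translate_compact_convex K t : compact_convex K -> compact_convex (translate K t).
Proof.
move=> [cK /convex_setP vK]; split.
  apply: continuous_image_compact => // x.
  by apply: cvgD; [exact: cvg_id|exact: cvg_cst].
apply/convex_setP => x y s /translateP Kx /translateP Ky s01; apply/translateP.
have := vK _ _ s Kx Ky s01; congr K.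
by apply: pair_ext; rewrite /= /GRing.scale /=; ring.
Qed.

Lemma translate_interior K t : K° !=set0 -> (translate K t)° !=set0.
Proof.
move=> [z /interior_ball [e e0 eK]]; exists (z + t); apply/interior_ball; exists e => //.
move=> x xe; apply/translateP; apply: eK; move: xe; rewrite -!ball_normE /=.
by rewrite opprB addrA.
Qed.

(** The maxima of a functional on two translates of [K] differ by its value on
    the difference of the translation vectors. *)
Lemma translate_inj K : compact K -> K !=set0 -> injective (translate K).
Proof.
move=> cK K0.
suff le t t' f : translate K t = translate K t' -> dot f t <= dot f t'.
  move=> t t' E.
  have eqf f : dot f t = dot f t' by apply/eqP; rewrite eq_le !le.
  apply: pair_ext.
    by have := eqf (1, 0); rewrite /dot /= !mul1r !mul0r !addr0.
  by have := eqf (0, 1); rewrite /dot /= !mul1r !mul0r !add0r.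
move=> E; have [a [b [_ Kb m]]] := dot_minmax f cK K0.
have : translate K t' (b + t) by rewrite -E; exists b.
by move=> /translateP /m /andP[_]; rewrite dotB dotD; lra.
Qed.

Lemma perp_surj f : f != 0 -> exists2 d, d != 0 & f = perp d.
Proof.
move=> f0; exists (f.2, - f.1); last by apply: pair_ext; rewrite /= ?opprK.
apply: contra_neq f0 => -[f2 /eqP]; rewrite oppr_eq0 => /eqP f1.
exact: pair_ext.
Qed.

Lemma vol_segment p e : vol (segment p e) = 0.
Proof.
have pt : vol (segment p 0) = 0.
  rewrite (_ : segment p 0 = `[p.1, p.1]%classic `*` `[p.2, p.2]%classic); last first.
    apply/seteqP; split=> x.
      by move=> /segmentP[s _ ->]; rewrite scaler0 addr0; split; rewrite /= in_itv /= lexx.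
    move=> [] /=; rewrite !in_itv /= => h1 h2.
    rewrite (_ : x = p); first exact: segment_left.
    by apply: pair_ext; apply/eqP; rewrite eq_le andbC.
  have mI (a : R) : measurable (`[a, a]%classic : set R) by exact: measurable_itv.
  rewrite /vol areaX//.
  have -> : lebesgue_measure (`[p.1, p.1]%classic : set R) = 0%E.
    by rewrite lebesgue_measure_itv /= lte_fin ltxx.
  by rewrite mul0e.
rewrite (_ : segment p e = minkowski_sum (segment p 0) (segment 0 e)).
  rewrite vol_minkowski_segment.
  - by rewrite pt width_segment dot0 normr0 addr0.
  - exact: segment_compact_convex.
  - exact: segment_neq0.
apply/seteqP; split=> x.
  move=> /segmentP[s s01 ->]; exists p; first exact: segment_left.
  by exists (s *: e) => //; apply/segmentP; exists s; rewrite ?add0r.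
move=> [_ /segmentP[s _ ->] [_ /segmentP[s' s01 ->] <-]].
by rewrite scaler0 addr0 add0r; apply/segmentP; exists s'.
Qed.

Lemma vol_in_line X f (c : R) : compact_convex X -> f != 0 ->
  (forall x, X x -> dot f x = c) -> vol X = 0.
Proof.
move=> cX f0 Xc; have [d d0 fd] := perp_surj f0.
have XI : X = X `&` [set x | dot (perp d) x = c].
  by apply/seteqP; split=> x; [move=> Xx; split => //=; rewrite -fd; exact: Xc|case].
have [X0|X0] := pselect (X !=set0).
  rewrite XI in X0; have [p [b [_ E]]] := chord cX d0 X0.
  by rewrite XI E vol_segment.
rewrite (_ : X = set0); first by rewrite /vol measure0.
by apply/seteqP; split=> // x Xx; apply: X0; exists x.
Qed.

End sides.

(** * Totally separable packings *)

Section half_difference.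
Variable R : realType.
Implicit Types (K : set (R * R)) (f x y : R * R).

(** Strips only see widths, so [K] may be replaced by the centrally symmetric
    body of the same widths. *)
Definition half_difference K : set (R * R) := [set 2^-1 *: (x - y) | x in K & y in K].

Lemma half_difference_compact_convex K : compact_convex K ->
  compact_convex (half_difference K).
Proof.
move=> cK; rewrite (_ : half_difference K =
    minkowski_sum (linmap (2^-1, 0) (0, 2^-1) @` K) (linmap (- 2^-1, 0) (0, - 2^-1) @` K)).
  by apply: minkowski_sum_compact_convex; exact: linmap_compact_convex.
have E x y : 2^-1 *: (x - y) =
    linmap (2^-1, 0) (0, 2^-1) x + linmap (- 2^-1, 0) (0, - 2^-1) y.
  by rewrite !linmapE; apply: pair_ext; rewrite /= /GRing.scale /=; ring.
apply/seteqP; split=> z /=.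
  by move=> [x Kx [y Ky <-]]; rewrite E; eexists; [exists x|eexists; [exists y|]].
by move=> [_ [x Kx <-] [_ [y Ky <-] <-]]; exists x => //; exists y.
Qed.

Lemma half_difference_sym K x : half_difference K x -> half_difference K (- x).
Proof.
by move=> [y Ky [z Kz <-]]; exists z => //; exists y; rewrite // -scalerN opprB.
Qed.

Lemma half_difference_neq0 K : K !=set0 -> half_difference K !=set0.
Proof. by move=> [x Kx]; exists (2^-1 *: (x - x)); exists x => //; exists x. Qed.

Lemma width_half_difference K f : compact K -> K !=set0 ->
  width (half_difference K) f = width K f.
Proof.
move=> cK K0; have [x [y [Kx Ky m]]] := dot_minmax f cK K0.
rewrite (widthE Kx Ky m) (@widthE _ _ _ (2^-1 *: (x - y)) (2^-1 *: (y - x))).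
- by rewrite !dotZ !dotB; field.
- by exists x => //; exists y.
- by exists y => //; exists x.
- move=> _ [u Ku [v Kv <-]]; rewrite !dotZ !dotB !ler_pM2l ?invr_gt0//.
  by have /andP[? ?] := m u Ku; have /andP[? ?] := m v Kv; apply/andP; split; exact: lerB.
Qed.

Lemma half_difference_disk K (r : R) : 0 <= r -> K `<=` disk r ->
  half_difference K `<=` disk r.
Proof.
move=> r0 Kr _ [x /Kr xr [y /Kr yr <-]].
rewrite (_ : r = 2^-1 * (r + r)); last by field.
by apply: disk_scale; apply: disk_add => //; exact: disk_opp.
Qed.

End half_difference.

Section finite_unions.
Variable R : realType.
Variables (T : eqType) (X : T -> set (R * R)).

Lemma bigU_compact (s : seq T) : (forall t, t \in s -> compact (X t)) ->
  compact (\big[setU/set0]_(t <- s) X t).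
Proof.
elim: s => [|t s IH] cX; first by rewrite big_nil; exact: compact0.
rewrite big_cons; apply: compactU; first by apply: cX; rewrite inE eqxx.
by apply: IH => u us; apply: cX; rewrite inE us orbT.
Qed.

Lemma vol_bigU_le (s : seq T) (m : R) :
  (forall t, t \in s -> compact (X t)) ->
  (forall t, t \in s -> vol (X t) <= m) ->
  vol (\big[setU/set0]_(t <- s) X t) <= (size s)%:R * m.
Proof.
elim: s => [|t s IH] cX Xm.
  by rewrite big_nil /vol measure0 mul0r.
have ct : compact (X t) by apply: cX; rewrite inE eqxx.
have cs u : u \in s -> compact (X u) by move=> us; apply: cX; rewrite inE us orbT.
rewrite big_cons /= -natr1 mulrDl mul1r addrC.
have U := volUI ct (bigU_compact cs).
apply: (@le_trans _ _ (vol (X t) + vol (\big[setU/set0]_(u <- s) X u))).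
  by rewrite -U lerDl vol_ge0.
apply: lerD; first by apply: Xm; rewrite inE eqxx.
by apply: IH => // u us; apply: Xm; rewrite inE us orbT.
Qed.

End finite_unions.

Lemma vol_bigU_almost_disjoint (R : realType) (T : eqType) (X : T -> set (R * R))
    (s : seq T) (m : R) : uniq s ->
  (forall t, t \in s -> compact (X t)) ->
  (forall t, t \in s -> vol (X t) = m) ->
  (forall t u, t \in s -> u \in s -> t != u -> vol (X t `&` X u) = 0) ->
  vol (\big[setU/set0]_(t <- s) X t) = (size s)%:R * m.
Proof.
elim: s => [|t s IH] us cX Xm dX.
  by rewrite big_nil /vol measure0 mul0r.
have ct : compact (X t) by apply: cX; rewrite inE eqxx.
have cs u : u \in s -> compact (X u) by move=> ?; apply: cX; rewrite inE orbC; apply/orP; left.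
move: us; rewrite /= => /andP[ts us].
rewrite big_cons -natr1 mulrDl mul1r addrC.
have U := volUI ct (bigU_compact cs).
have I0 : vol (X t `&` \big[setU/set0]_(u <- s) X u) = 0.
  apply/eqP; rewrite eq_le vol_ge0 andbT.
  rewrite (_ : _ `&` _ = \big[setU/set0]_(u <- s) (X t `&` X u)); last first.
    by rewrite big_distrr.
  apply: le_trans (vol_bigU_le (m := 0) _ _) _.
  - by move=> u /cs cu; exact: compactI2.
  - move=> u us'; rewrite dX ?inE ?eqxx ?us' ?orbT//.
    by apply: contraNneq ts => ->.
  - by rewrite mulr0.
move: U; rewrite I0 addr0 => ->; congr (_ + _).
  by apply: Xm; rewrite inE eqxx.
apply: IH => // [u us'|u v us' vs' uv].
  by apply: Xm; rewrite inE us' orbT.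
by apply: dX; rewrite // inE ?us' ?vs' orbT.
Qed.

Section packings.
Variable R : realType.
Variable K : set (R * R).
Hypothesis cK : compact_convex K.
Hypothesis iK : K° !=set0.
Implicit Types (F : set (set (R * R))) (f p t u v x y : R * R) (s : seq (R * R)).

Let K0 : K !=set0. Proof. by have [x /interior_subset] := iK; exists x. Qed.

Lemma separating_line F t t' : family_of_translates K F -> totally_separable F ->
  F (translate K t) -> F (translate K t') -> t != t' ->
  exists f (c : R), [/\ f != 0, forall x, translate K t x -> dot f x <= c,
    forall x, translate K t' x -> c <= dot f x &
    forall A, F A -> (forall x, A x -> dot f x <= c) \/ (forall x, A x -> c <= dot f x)].
Proof.
move=> fF sF Ft Ft' tt'.
have nE : translate K t <> translate K t'.
  by move/(translate_inj cK.1 K0); apply/eqP.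
have [a [b [c [ab [lo hi] off]]]] := sF _ _ Ft Ft' nE.
exists (a, b), c; split => //; first by apply/eqP.
move=> A FA; have [z AE] := fF _ FA; rewrite AE in FA *.
apply: one_side.
- by have [] := translate_compact_convex z cK.
- exact: translate_interior.
- move=> x ix; apply/eqP => xc.
  by have : (line a b c `&` (translate K z)°) x by []; rewrite off.
Qed.

(** A line missing the interiors keeps the translation vectors at a distance
    on either side: with [a] and [b] the points of [K] where the functional is
    least and largest, no vector has a value strictly between [c - dot f b] and
    [c - dot f a]. *)
Lemma translates_separated_by_strips F s : family_of_translates K F ->
  totally_separable F -> (forall t, t \in s -> F (translate K t)) ->
  separated_by_strips (half_difference K) s.
Proof.
move=> fF sF Fs x y xs ys xy.
have [f [c [f0 fx fy side]]] := separating_line fF sF (Fs _ xs) (Fs _ ys) xy.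
have [d d0 fd] := perp_surj f0.
have [a [b [Ka Kb m]]] := dot_minmax f cK.1 K0.
have lo t : (forall x, translate K t x -> dot f x <= c) -> dot f t <= c - dot f b.
  by move=> H; have := H (b + t); rewrite dotD => /(_ _)/wrap[]; [exists b|lra].
have hi t : (forall x, translate K t x -> c <= dot f x) -> c - dot f a <= dot f t.
  by move=> H; have := H (a + t); rewrite dotD => /(_ _)/wrap[]; [exists a|lra].
exists d, (c - dot f b), (c - dot f a); rewrite -fd; split => //.
- by rewrite width_half_difference//; [rewrite (widthE Ka Kb m); ring|exact: cK.1].
- exact: lo.
- exact: hi.
- by move=> z zs; have [/lo|/hi] := side _ (Fs _ zs); [left|right].
Qed.

Lemma almost_disjoint F t t' : family_of_translates K F -> totally_separable F ->
  F (translate K t) -> F (translate K t') -> t != t' ->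
  vol (translate K t `&` translate K t') = 0.
Proof.
move=> fF sF Ft Ft' tt'.
have [f [c [f0 lo hi _]]] := separating_line fF sF Ft Ft' tt'.
have [c1 v1] := translate_compact_convex t cK.
have [c2 v2] := translate_compact_convex t' cK.
apply: (@vol_in_line _ _ f c) => //.
  split; last exact: convex_setI.
  exact: compactI2.
by move=> x [/lo ? /hi ?]; apply/eqP; rewrite eq_le; apply/andP.
Qed.

Variable A : R.
Hypothesis A0 : 0 < A.
Hypothesis widthA : forall f g, `|det2 f g| * A <= width K f * width K g.
(* A translate of [K] that meets a disk is contained in the concentric disk whose
   radius is larger by [2 * rho]. *)
Variable rho : R.
Hypothesis rho0 : 0 < rho.
Hypothesis Krho : K `<=` disk rho.

Local Notation v0 := (vol (disk (1 : R))).

Lemma count_translates F s (r : R) : family_of_translates K F ->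
  totally_separable F -> 0 < r -> uniq s ->
  (forall t, t \in s -> F (translate K t) /\ translate K t `&` disk r !=set0) ->
  (size s)%:R * A <= (r + 2 * rho) ^+ 2 * v0 + A.
Proof.
move=> fF sF r0 us Fs.
have R0 : 0 <= r + rho by rewrite addr_ge0// ltW.
have [->|s0] := eqVneq s [::].
  by rewrite mul0r addr_ge0 ?(ltW A0)// mulr_ge0 ?sqr_ge0 ?vol_ge0.
pose W := half_difference K.
have cW : compact_convex W by exact: half_difference_compact_convex.
have wW f : width W f = width K f by exact: width_half_difference cK.1 K0.
have H : (size s)%:R * A + vol W <= vol (minkowski_sum W (disk (r + rho))) + A.
  apply: count_strip_separated => //.
  - exact: half_difference_neq0.
  - by move=> x; exact: half_difference_sym.
  - by move=> f g; rewrite !wW.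
  - by move=> f f0; rewrite wW; apply: width_gt0 => //; exact: cK.1.
  - exact: disk_compact_convex.
  - move=> t /Fs[_ [_ [[k Kk <-] kr]]].
    rewrite -(addrK k t) [t + k]addrC; apply: disk_add => //; try exact: ltW.
    by apply: disk_opp; exact: Krho.
  - by apply: translates_separated_by_strips fF sF _ => t /Fs[].
apply: (@le_trans _ _ (vol (minkowski_sum W (disk (r + rho))) + A)).
  by apply: le_trans H; rewrite lerDl vol_ge0.
rewrite lerD2r -vol_disk; last by rewrite addr_gt0// mulr_gt0.
have cD := disk_compact_convex R0.
apply: le_vol.
- by have [] := minkowski_sum_compact_convex cW cD.
- by have [] := @disk_compact_convex _ (r + 2 * rho) (addr_ge0 (ltW r0) (mulr_ge0 (ler0n _ _) (ltW rho0))).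
- move=> _ [w Ww [x xr <-]].
  rewrite (_ : r + 2 * rho = rho + (r + rho)); last by ring.
  by apply: disk_add => //; [exact: ltW|exact: (half_difference_disk (ltW rho0) Krho)].
Qed.

(** The count bounds the size of every finite set of such vectors. *)
Lemma finite_translates F (r : R) : family_of_translates K F ->
  totally_separable F -> 0 < r -> exists s, uniq s /\
  forall t, t \in s <-> F (translate K t) /\ translate K t `&` disk r !=set0.
Proof.
move=> fF sF r0.
pose G := [set t | F (translate K t) /\ translate K t `&` disk r !=set0].
have [finG|infG] := pselect (finite_set G).
  have /finite_seqP[s sE] := finG; exists (undup s); split; first exact: undup_uniq.
  move=> t; rewrite mem_undup; have -> : (t \in s) = [set` s] t :> Prop by [].
  by rewrite -sE.
pose B := ((r + 2 * rho) ^+ 2 * v0 + A) / A.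
have B0 : 0 <= B.
  by rewrite divr_ge0 ?(ltW A0)// addr_ge0 ?(ltW A0)// mulr_ge0 ?sqr_ge0 ?vol_ge0.
have [S SG nS] := infinite_set_fset (Num.truncn B).+1 infG.
have := count_translates fF sF r0 (finmap.fset_uniq S) SG.
rewrite -ler_pdivlMr// -/B leNgt => /negP[].
apply: lt_le_trans (truncnS_gt B) _.
by rewrite ler_nat.
Qed.

Lemma in_disk_bigU F (r : R) s : family_of_translates K F ->
  (forall t, t \in s <-> F (translate K t) /\ translate K t `&` disk r !=set0) ->
  (\bigcup_(X in F) X) `&` disk r = \big[setU/set0]_(t <- s) (translate K t `&` disk r).
Proof.
move=> fF sE; rewrite -bigcup_seq; apply/seteqP; split=> x.
  move=> [[X FX Xx] xr]; have [t XE] := fF _ FX; rewrite XE in FX Xx.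
  by exists t => //=; apply/sE; split => //; exists x.
by move=> [t /= /sE[Ft _] [tx xr]]; split => //; exists (translate K t).
Qed.

Lemma in_disk_compact (r : R) t : 0 < r -> compact (translate K t `&` disk r).
Proof.
move=> r0; have [c1 _] := translate_compact_convex t cK.
have [c2 _] := disk_compact_convex (ltW r0).
exact: compactI2.
Qed.

Lemma covered_compact F (r : R) : family_of_translates K F -> totally_separable F ->
  0 < r -> compact ((\bigcup_(X in F) X) `&` disk r).
Proof.
move=> fF sF r0; have [s [_ sE]] := finite_translates fF sF r0.
rewrite (in_disk_bigU fF sE); apply: bigU_compact => t _; exact: in_disk_compact.
Qed.

Lemma vol_translateK t : vol (translate K t) = vol K.
Proof. by apply: vol_translate; exact: compact_measurable2 cK.1. Qed.

Lemma vol_covered_le F (r : R) : family_of_translates K F -> totally_separable F ->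
  0 < r -> vol ((\bigcup_(X in F) X) `&` disk r) * A <=
    vol K * ((r + 2 * rho) ^+ 2 * v0 + A).
Proof.
move=> fF sF r0; have [s [us sE]] := finite_translates fF sF r0.
have count := count_translates fF sF r0 us (fun t => (sE t).1).
rewrite (in_disk_bigU fF sE).
apply: (@le_trans _ _ (((size s)%:R * vol K) * A)).
  rewrite ler_pM2r//; apply: vol_bigU_le => t _; first exact: in_disk_compact.
  rewrite -(vol_translateK t); apply: le_vol; first exact: in_disk_compact.
    by have [] := translate_compact_convex t cK.
  by move=> x [].
by rewrite mulrAC mulrC ler_wpM2l// vol_ge0.
Qed.

Lemma vol_covered_ge F (r : R) s : family_of_translates K F -> totally_separable F ->
  0 < r -> uniq s ->
  (forall t, t \in s -> F (translate K t) /\ translate K t `<=` disk r) ->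
  (size s)%:R * vol K <= vol ((\bigcup_(X in F) X) `&` disk r).
Proof.
move=> fF sF r0 us Fs.
rewrite -(@vol_bigU_almost_disjoint _ _ (translate K) s) //; first last.
- by move=> t t' ts t's; apply: almost_disjoint fF sF _ _; [have [] := Fs _ ts|have [] := Fs _ t's].
- by move=> t _; exact: vol_translateK.
- by move=> t _; have [] := translate_compact_convex t cK.
apply: le_vol.
- by apply: bigU_compact => t _; have [] := translate_compact_convex t cK.
- exact: covered_compact.
- rewrite -bigcup_seq => x [t /= ts tx]; have [Ft tr] := Fs _ ts.
  by split; [exists (translate K t)|exact: tr].
Qed.

Lemma density_ratio F (r : R) : family_of_translates K F -> totally_separable F ->
  0 < r -> (area ((\bigcup_(X in F) X) `&` dilate r (@unit_disk R))
       / area (dilate r (@unit_disk R)))%E =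
  (vol ((\bigcup_(X in F) X) `&` disk r) / (r ^+ 2 * v0))%:E.
Proof.
move=> fF sF r0; rewrite dilate_unit_disk//.
rewrite (area_compact (covered_compact fF sF r0)).
have [cD _] := disk_compact_convex (ltW r0).
rewrite (area_compact cD) vol_disk// inver ifF; last first.
  by apply/negbTE; rewrite mulf_neq0 ?sqrf_eq0 ?lt0r_neq0// vol_unit_disk_gt0.
by rewrite -EFinM.
Qed.

Lemma upper_density_le F : family_of_translates K F -> totally_separable F ->
  (upper_density F <= (vol K / A)%:E)%E.
Proof.
move=> fF sF; apply/lee_addgt0Pr => e e0.
have v00 : 0 < v0 :> R := vol_unit_disk_gt0 R.
set L := vol K / A; have L0 : 0 <= L by rewrite divr_ge0 ?vol_ge0 ?ltW.
(* for [1 <= r] the excess over the area of the disk is at most [C * v0 * r] *)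
pose C := 4 * rho + 4 * rho ^+ 2 + A / v0.
have C0 : 0 < C by apply: addr_gt0; [apply: addr_gt0; rewrite mulr_gt0 ?exprn_gt0|exact: divr_gt0].
pose r1 := Num.max 1 (L * C / e).
apply: ge_ereal_inf; eexists.
  by exists [set r | r1 < r] => //; apply: nbhs_pinfty_gt; exact: num_real.
apply: ge_ereal_sup => _ [r /= r1r <-].
move: r1r; rewrite gt_max ltr_pdivrMr// => /andP[r_gt1 rL].
have r0 : 0 < r by apply: lt_trans r_gt1.
rewrite density_ratio// -EFinD lee_fin ler_pdivrMr ?mulr_gt0 ?exprn_gt0//.
have := vol_covered_le fF sF r0.
move: (vol (_ `&` _)) => V HV.
have VL : V <= L * ((r + 2 * rho) ^+ 2 * v0 + A).
  by rewrite /L mulrAC ler_pdivlMr.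
apply: le_trans VL _.
have E : (r + 2 * rho) ^+ 2 * v0 + A <= r ^+ 2 * v0 + C * v0 * r.
  have -> : C * v0 * r = (4 * rho + 4 * rho ^+ 2) * v0 * r + A * r.
    by rewrite /C; field; rewrite lt0r_neq0.
  rewrite -subr_ge0.
  rewrite (_ : _ - _ = (4 * rho ^+ 2 * v0 + A) * (r - 1)); last by ring.
  apply: mulr_ge0; last by rewrite subr_ge0 ltW.
  by apply: addr_ge0; [rewrite !mulr_ge0 ?sqr_ge0 ?ltW|exact: ltW].
apply: le_trans (ler_wpM2l L0 E) _.
rewrite [leLHS]mulrDr [leRHS]mulrDl lerD2l.
rewrite (_ : L * _ = (L * C) * (v0 * r)); last by ring.
rewrite (_ : e * _ = (r * e) * (v0 * r)); last by ring.
by rewrite ler_wpM2r ?(ltW rL)// mulr_ge0 ?ltW.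
Qed.

Lemma dual_functionals (u v : R * R) : det2 u v != 0 ->
  exists f g, [/\ dot f u = 1, dot f v = 0, dot g u = 0, dot g v = 1 &
    forall x, x = dot f x *: u + dot g x *: v].
Proof.
move=> D0.
exists ((det2 u v)^-1 * v.2, - ((det2 u v)^-1 * v.1)).
exists (- ((det2 u v)^-1 * u.2), (det2 u v)^-1 * u.1).
split => [||||x]; last first.
  by apply: pair_ext; rewrite /dot /det2 /= /GRing.scale /= in D0 *; field.
all: by rewrite /dot /det2 /= in D0 *; field.
Qed.

Lemma packing_of_totally_separable F : totally_separable F -> packing F.
Proof.
move=> sF X Y FX FY XY; have [a [b [c [_ [lo hi] off]]]] := sF X Y FX FY XY.
apply/seteqP; split=> // x [iX iY].
have : (line a b c `&` X°) x; last by rewrite off.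
split => //; rewrite /line /=; apply/eqP; rewrite eq_le.
by rewrite lo ?hi//; exact: interior_subset.
Qed.

Definition lattice_packing (u v : R * R) : set (set (R * R)) :=
  [set X | exists i j : int, X = translate K (i%:~R *: u + j%:~R *: v)].

Lemma lattice_translates u v : family_of_translates K (lattice_packing u v).
Proof. by move=> X [i [j ->]]; eexists. Qed.

(** The functional dual to [u] maps the translate with coefficients [i] and [j]
    into an interval of length [1] that starts at [i], up to a common shift; the
    end points of these intervals give the separating lines. *)
Lemma lattice_totally_separable p u v : det2 u v != 0 -> K `<=` parallelogram p u v ->
  totally_separable (lattice_packing u v).
Proof.
move=> D0 KP.
have [f [g [fu fv gu gv _]]] := dual_functionals D0.
(* [l i j] is the coefficient that [h] reads off: [i] for the functional dual to
   [u], and [j] for the one dual to [v] *)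
have strips h (l : int -> int -> int) : h != 0 ->
    (forall i j (x : R * R), translate K (i%:~R *: u + j%:~R *: v) x ->
      dot h p + (l i j)%:~R <= dot h x <= dot h p + (l i j)%:~R + 1) ->
    forall i j i' j', l i j != l i' j' ->
    exists a b c, [/\ (a, b) <> (0, 0),
      separates a b c (translate K (i%:~R *: u + j%:~R *: v))
                      (translate K (i'%:~R *: u + j'%:~R *: v)) &
      forall C, lattice_packing u v C -> line a b c `&` C° = set0].
  move=> h0 hl.
  have int_le (m n : int) : m < n -> m%:~R + 1 <= n%:~R :> R.
    by move=> mn; rewrite -[1](mulr1z 1) -intrD ler_int lezD1.
  have off (n : int) C : lattice_packing u v C -> forall x, C° x ->
      dot h x != dot h p + n%:~R.
    move=> [i [j ->]]; apply: interior_off_line => //.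
    have [nl|nl] := leP n (l i j); [right|left] => x /hl/andP[lo hi].
      by apply: le_trans lo; rewrite lerD2l ler_int.
    by apply: le_trans hi _; rewrite -addrA lerD2l int_le.
  move=> i j i' j'; rewrite neq_lt => /orP[ll|ll].
    exists h.1, h.2, (dot h p + (l i' j')%:~R); split.
    - by rewrite -surjective_pairing; exact/eqP.
    - split=> x /hl/andP[lo hi] //.
      by apply: le_trans hi _; rewrite -addrA lerD2l int_le.
    - move=> C FC; apply/seteqP; split=> // x [/= xl ix].
      by case/eqP: (off (l i' j') _ FC _ ix).
  exists (- h).1, (- h).2, (- (dot h p + (l i j)%:~R)); split.
  - by rewrite -surjective_pairing; apply/eqP; rewrite oppr_eq0.
  - have E x : (- h).1 * x.1 + (- h).2 * x.2 = - dot h x by rewrite /dot /=; ring.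
    split=> x /hl/andP[lo hi]; rewrite E lerN2 //.
    by apply: le_trans hi _; rewrite -addrA lerD2l int_le.
  - move=> C FC; apply/seteqP; split=> // x [/= xl ix].
    case/eqP: (off (l i j) _ FC _ ix); apply: oppr_inj.
    by rewrite -xl /dot /=; ring.
have f0 : f != 0.
  by apply/eqP => fE; move: fu; rewrite fE /dot /= !mul0r addr0 => /esym/eqP; rewrite oner_eq0.
have g0 : g != 0.
  by apply/eqP => gE; move: gv; rewrite gE /dot /= !mul0r addr0 => /esym/eqP; rewrite oner_eq0.
have fK i j x : translate K (i%:~R *: u + j%:~R *: v) x ->
    dot f p + i%:~R <= dot f x <= dot f p + i%:~R + 1.
  move=> [y /KP [s [t [s01 _ ->]]] <-]; rewrite !dotD !dotZ fu fv !mulr1 !mulr0 !addr0.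
  by have /andP[? ?] := s01; apply/andP; split; lra.
have gK i j x : translate K (i%:~R *: u + j%:~R *: v) x ->
    dot g p + j%:~R <= dot g x <= dot g p + j%:~R + 1.
  move=> [y /KP [s [t [_ t01 ->]]] <-]; rewrite !dotD !dotZ gu gv !mulr1 !mulr0 !addr0 !add0r.
  by have /andP[? ?] := t01; apply/andP; split; lra.
move=> X Y [i [j ->]] [i' [j' ->]] nXY.
have [ii|ii] := eqVneq i i'; last exact: (strips f (fun i _ => i) f0 fK).
have [jj|jj] := eqVneq j j'; last exact: (strips g (fun _ j => j) g0 gK).
by case: nXY; rewrite ii jj.
Qed.

(** The cells of the lattice that meet a smaller disk cover it and lie in the
    larger one. *)
Lemma vol_lattice_ge p u v (r : R) : det2 u v != 0 -> K `<=` parallelogram p u v ->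
  parallelogram p u v `<=` disk rho -> 2 * rho < r ->
  (r - 2 * rho) ^+ 2 * v0 * vol K <=
    `|det2 u v| * vol ((\bigcup_(X in lattice_packing u v) X) `&` disk r).
Proof.
move=> D0 KP Prho rr.
pose P := parallelogram p u v.
set F := lattice_packing u v.
have fF : family_of_translates K F by exact: lattice_translates.
have sF : totally_separable F by exact: lattice_totally_separable KP.
have rho2 : 0 < 2 * rho by rewrite mulr_gt0.
have r0 : 0 < r by exact: lt_trans rr.
have r'0 : 0 < r - 2 * rho by rewrite subr_gt0.
have [s [us sE]] := finite_translates fF sF r0.
pose s' := [seq t <- s | `[< translate P t `&` disk (r - 2 * rho) !=set0 >]].
have inside t : translate P t `&` disk (r - 2 * rho) !=set0 -> translate P t `<=` disk r.
  move=> [_ [[k /Prho kP <-] kr]] _ [k' /Prho k'P <-].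
  rewrite (_ : k' + t = (k' - k) + (k + t)); last by apply: pair_ext => /=; ring.
  rewrite (_ : r = (rho + rho) + (r - 2 * rho)); last by ring.
  apply: disk_add => //; [by rewrite addr_ge0// ltW|exact: ltW|].
  by apply: disk_add; rewrite ?ltW//; exact: disk_opp.
have KPt t : translate K t `<=` translate P t by move=> _ [k /KP kP <-]; exists k.
have low := vol_covered_ge fF sF r0 (filter_uniq _ us : uniq s').
have {}low : (size s')%:R * vol K <= vol ((\bigcup_(X in F) X) `&` disk r).
  apply: low => t; rewrite mem_filter => /andP[/asboolP tP /sE[Ft _]]; split => //.
  by apply: subset_trans (inside _ tP); exact: KPt.
have cP : compact P by exact: parallelogram_compact.
have cPt t : compact (translate P t).
  apply: continuous_image_compact => // x.
  by apply: cvgD; [exact: cvg_id|exact: cvg_cst].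
have cover : vol (disk (r - 2 * rho)) <= (size s')%:R * `|det2 u v|.
  apply: le_trans (vol_bigU_le (X := translate P) (s := s') (m := `|det2 u v|) _ _).
  - apply: le_vol; first by have [] := disk_compact_convex (ltW r'0).
      by apply: bigU_compact => t _; exact: cPt.
    have [f [g [_ _ _ _ repr]]] := dual_functionals D0.
    move=> x xr; pose y := x - p.
    pose i := Num.floor (dot f y); pose j := Num.floor (dot g y).
    pose t := i%:~R *: u + j%:~R *: v.
    have xP : translate P t x.
      apply/translateP; exists (dot f y - i%:~R), (dot g y - j%:~R).
      have /andP[i1 i2] := floor_itv (dot f y); have /andP[j1 j2] := floor_itv (dot g y).
      rewrite -/i intrD in i1 i2; rewrite -/j intrD in j1 j2.
      split; [by apply/andP; split; lra|by apply/andP; split; lra|].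
      rewrite (_ : x = p + y); last by rewrite /y addrC subrK.
      rewrite {1}(repr y) /t.
      by apply: pair_ext; rewrite /= /GRing.scale /=; ring.
    have tP : translate P t `&` disk (r - 2 * rho) !=set0 by exists x.
    rewrite -bigcup_seq; exists t => //=; rewrite mem_filter; apply/andP; split; first exact/asboolP.
    apply/sE; split; first by exists i, j.
    have [k Kk] := K0; exists (k + t); split; first by exists k.
    by apply: (inside _ tP); apply: KPt; exists k.
  - by move=> t _; exact: cPt.
  - by move=> t _; rewrite vol_translate ?vol_parallelogram//; exact: compact_measurable2.
rewrite -vol_disk//.
apply: le_trans (ler_wpM2r (vol_ge0 K) cover) _.
by rewrite mulrAC mulrC ler_wpM2l.
Qed.

Lemma upper_density_lattice_ge p u v : `|det2 u v| = A ->
  K `<=` parallelogram p u v -> parallelogram p u v `<=` disk rho ->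
  ((vol K / A)%:E <= upper_density (lattice_packing u v))%E.
Proof.
move=> DA KP Prho.
have D0 : det2 u v != 0 by rewrite -normr_gt0 DA.
set F := lattice_packing u v.
have fF : family_of_translates K F by exact: lattice_translates.
have sF : totally_separable F by exact: lattice_totally_separable KP.
have v00 : 0 < v0 := vol_unit_disk_gt0 R.
set L := vol K / A; have L0 : 0 <= L by rewrite divr_ge0 ?vol_ge0 ?ltW.
apply: le_ereal_inf_tmp => _ [V nV <-].
apply/lee_addgt0Pr => e e0.
(* [L * (r - 2 * rho) ^+ 2 >= (L - e) * r ^+ 2] as soon as [r * e] exceeds
   [4 * L * rho] *)
pose r1 := Num.max (2 * rho) (4 * L * rho / e).
have [r [Vr r1r]] : exists r, V r /\ r1 < r.
  have : pinfty_nbhs R (V `&` [set r | r1 < r]).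
    by apply: filterI => //; apply: nbhs_pinfty_gt; exact: num_real.
  by move=> /filter_ex [r [? ?]]; exists r.
move: r1r; rewrite gt_max ltr_pdivrMr// => /andP[rr rL].
have r0 : 0 < r by apply: lt_trans rr; rewrite mulr_gt0.
apply: (@le_trans _ _ ((L - e)%:E + e%:E)%E); first by rewrite -EFinD subrK.
apply: leeD => //.
apply: le_ereal_sup_tmp; eexists; first by exists r.
rewrite density_ratio// lee_fin ler_pdivlMr ?mulr_gt0 ?exprn_gt0//.
have := vol_lattice_ge D0 KP Prho rr.
rewrite DA -/F; move: (vol (_ `&` _)) => U HU.
have LU : L * ((r - 2 * rho) ^+ 2 * v0) <= U.
  by rewrite /L mulrAC ler_pdivrMr// mulrC [U * _]mulrC.
apply: le_trans LU.
rewrite -subr_ge0 (_ : _ - _ = ((r * e - 4 * L * rho) * r + 4 * L * rho ^+ 2) * v0); last by ring.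
apply: mulr_ge0; last exact: ltW.
apply: addr_ge0; first by apply: mulr_ge0; [rewrite subr_ge0 ltW|exact: ltW].
by apply: mulr_ge0; [exact: mulr_ge0|exact: sqr_ge0].
Qed.

End packings.

Theorem theorem2 (R : realType) (K : set (R * R)) (hK : convex_domain K) :
  (exists P : set (R * R), min_area_circumscribed_parallelogram K P) /\
  (forall P : set (R * R), min_area_circumscribed_parallelogram K P ->
     delta_sep K = (area K / area P)%E).
Proof.
have [cK vK iK] := hK; have ccK : compact_convex K by [].
have [A [A0 widthA exP minP]] := min_parallelogram cK iK.
split => // P mP.
have areaP := minP P mP.
have [[p [u [v [D0 PE KP _]]]] _] := mP.
rewrite -/(det2 u v) in D0.
have DA : `|det2 u v| = A.
  by move: areaP; rewrite PE area_parallelogram// => -[].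
have [rho rho0 Prho] := compact_sub_disk (@parallelogram_compact _ p u v).
rewrite PE in KP.
have Krho : K `<=` disk rho by exact: subset_trans Prho.
rewrite areaP (area_compact cK) inver (gt_eqF A0) -EFinM.
apply/eqP; rewrite eq_le; apply/andP; split.
  by apply: ge_ereal_sup => _ [F [fF _ sF] <-]; exact: (upper_density_le ccK iK A0 widthA rho0 Krho).
have sF := lattice_totally_separable D0 KP.
apply: le_trans (upper_density_lattice_ge ccK iK A0 widthA rho0 Krho DA KP Prho) _.
apply: ereal_sup_ubound; exists (lattice_packing K u v) => //; split => //.
  exact: lattice_translates.
exact: packing_of_totally_separable.
Qed.
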